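(* Let $N\ge 2$ and $k\in\mathbb{N}$, and let $u\in F_k\subseteq\mathcal{O}_N$ be a unitary. Then the noncommutative topological entropy of the endomorphism $\rho_u$ of $\mathcal{O}_N$ satisfies $$\mathrm{ht}(\rho_u)\le (k-1)\log N .$$ In particular, if $\sigma$ is a permutation of $\mathcal{J}_k$, then the permutative endomorphism $\rho_\sigma$ satisfies $\mathrm{ht}(\rho_\sigma)\le (k-1)\log N$.
   Context: $\mathbb{N}=\{1,2,\dots\}$. The Cuntz algebra $\mathcal{O}_N$ is the unique $C^*$-algebra generated by isometries $s_1,\dots,s_N$ with $s_i^*s_j=\delta_{i,j}1$ and $\sum_{i=1}^N s_is_i^*=1$; it is unital, simple and nuclear. For $k\in\mathbb{N}$ let $\mathcal{J}_k=\{1,\dots,N\}^k$, and for $J=(j_1,\dots,j_k)\in\mathcal{J}_k$ let $s_J=s_{j_1}\cdots s_{j_k}$. Let $F_k=\mathrm{span}\{s_Is_J^*: I,J\in\mathcal{J}_k\}$, which is isomorphic to $M_{N^k}$. For a unitary $u\in\mathcal{O}_N$, $\rho_u:\mathcal{O}_N\to\mathcal{O}_N$ denotes the unique unital $*$-endomorphism with $\rho_u(s_i)=us_i$ for $i=1,\dots,N$. For a permutation $\sigma$ of $\mathcal{J}_k$, put $u_\sigma=\sum_{J\in\mathcal{J}_k}s_{\sigma(J)}s_J^*$, a unitary in $F_k$, and $\rho_\sigma=\rho_{u_\sigma}$ (the permutative endomorphism given by $\sigma$). Noncommutative topological entropy (Voiculescu): let $\mathsf{A}$ be a unital nuclear $C^*$-algebra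 and $\gamma:\mathsf{A}\to\mathsf{A}$ a unital completely positive (ucp) map. For a finite set $\Omega\subset\mathsf{A}$ and $\varepsilon>0$, let $CPA(\mathsf{A},\Omega,\varepsilon)$ be the collection of triples $(\phi,\psi,C)$ where $C$ is a finite-dimensional $C^*$-algebra, $\phi:C\to\mathsf{A}$ and $\psi:\mathsf{A}\to C$ are ucp maps, and $\|\phi\circ\psi(a)-a\|<\varepsilon$ for all $a\in\Omega$. Let $\mathrm{rcp}(\Omega,\varepsilon)=\min\{\mathrm{rank}\,C:(\phi,\psi,C)\in CPA(\mathsf{A},\Omega,\varepsilon)\}$, where $\mathrm{rank}\,C$ is the dimension of a maximal abelian subalgebra of $C$. Put $\Omega^{(n)}=\bigcup_{j=0}^n\gamma^j(\Omega)$ and $$\mathrm{ht}(\gamma)=\sup_{\varepsilon>0,\ \Omega\subset\mathsf{A}\text{ finite}}\ \limsup_{n\to\infty}\frac1n\log\mathrm{rcp}(\Omega^{(n)},\varepsilon).$$ *)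

(* Defs.v *)
From HB Require Import structures.
From mathcomp Require Import all_boot all_order all_algebra all_fingroup all_field.
From mathcomp Require Import complex.
From mathcomp Require Import all_classical all_reals all_analysis.

Set Implicit Arguments.
Unset Strict Implicit.
Unset Printing Implicit Defensive.

Import Order.TTheory GRing.Theory Num.Theory.
Import numFieldNormedType.Exports.

Local Open Scope classical_set_scope.
Local Open Scope complex_scope.
Local Open Scope ring_scope.

(* Unital C*-algebras over R[i]; MathComp algebras are nontrivial (1 != 0). The
   real-valued norm is a field of the structure, because Hierarchy-Builder has no
   join of rings with normed modules over a general field. *)
HB.mixin Record isCStar (R : realType) A of GRing.Algebra R[i] A := {
  star : A -> A;
  starK : involutive star;
  starD : forall x y : A, star (x + y) = star x + star y;
  starZ : forall (a : R[i]) (x : A), star (a *: x) = a^* *: star x;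
  starM : forall x y : A, star (x * y) = star y * star x;
  cnorm : A -> R;
  cnorm_eq0 : forall x : A, cnorm x = 0 -> x = 0;
  cnormD : forall x y : A, cnorm (x + y) <= cnorm x + cnorm y;
  cnormZ : forall (a : R[i]) (x : A), (cnorm (a *: x))%:C = `|a| * (cnorm x)%:C;
  cnormM : forall x y : A, cnorm (x * y) <= cnorm x * cnorm y;
  cnorm_star : forall x : A, cnorm (star x * x) = cnorm x ^+ 2;
  cnorm_complete : forall x : nat -> A,
    (forall eps : R, 0 < eps -> exists n0, forall m n, (n0 <= m)%N -> (n0 <= n)%N ->
       cnorm (x m - x n) < eps) ->
    exists l : A, (fun n => cnorm (x n - l)) @ \oo --> (0 : R)
}.

#[short(type="cstarType")]
HB.structure Definition CStar (R : realType) :=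
  {A of GRing.Algebra R[i] A & isCStar R A}.

(* falgType is the type of finite-dimensional unital algebras; every such algebra
   carries its unit-ring structure (see Algebra_isFalgebra). *)
#[short(type="finCStarType")]
HB.structure Definition FinCStar (R : realType) :=
  {A of Falgebra R[i] A & isCStar R A}.

Definition unitary_elt (R : realType) (A : cstarType R) (u : A) : Prop :=
  star u * u = 1 /\ u * star u = 1.

Section CompletelyPositive.
Variable R : realType.

Definition mxstar (A : cstarType R) n (X : 'M[A]_n) : 'M[A]_n :=
  \matrix_(i, j) star (X j i).

(* Positivity in the C*-algebra M_n(A). *)
Definition mxpositive (A : cstarType R) n (X : 'M[A]_n) : Prop :=
  exists Y : 'M[A]_n, X = mxstar Y *m Y.

Definition completely_positive (A B : cstarType R) (f : A -> B) : Prop :=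
  forall n (X : 'M[A]_n), mxpositive X -> mxpositive (map_mx f X).

Definition ucp (A B : cstarType R) (f : {linear A -> B}) : Prop :=
  f 1 = 1 /\ completely_positive f.

End CompletelyPositive.

Section Rank.
Variables (R : realType) (C : finCStarType R).

Definition abelian_star_subalgebra (V : {vspace C}) : Prop :=
  [/\ forall x y, x \in V -> y \in V -> x * y \in V,
      forall x, x \in V -> star x \in V
    & forall x y, x \in V -> y \in V -> x * y = y * x].

Definition maximal_abelian (V : {vspace C}) : Prop :=
  abelian_star_subalgebra V /\
  forall W : {vspace C}, abelian_star_subalgebra W -> (V <= W)%VS -> W = V.

(* All maximal abelian *-subalgebras of C have the same dimension, so rank is a
   functional relation. *)
Definition has_rank (r : nat) : Prop :=
  exists2 V : {vspace C}, maximal_abelian V & (\dim V)%VS = r.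

End Rank.

Section Entropy.
Variables (R : realType) (A : cstarType R).

Definition CPA (Omega : set A) (eps : R) (C : finCStarType R)
    (phi : {linear C -> A}) (psi : {linear A -> C}) : Prop :=
  [/\ ucp phi, ucp psi
    & forall a, Omega a -> cnorm (phi (psi a) - a) < eps].

(* The minimum over a nonempty set of naturals is its infimum in \bar R; for an
   empty set (which cannot occur for A nuclear and Omega finite) it is +oo. *)
Definition rcp (Omega : set A) (eps : R) : \bar R :=
  ereal_inf [set r%:R%:E | r in [set r : nat |
    exists (C : finCStarType R) (phi : {linear C -> A}) (psi : {linear A -> C}),
      CPA Omega eps phi psi /\ has_rank C r]].

Definition iterates (gamma : A -> A) (Omega : set A) (n : nat) : set A :=
  \bigcup_(j in [set j | (j <= n)%N]) (iter j gamma @` Omega).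

Definition ht (gamma : A -> A) : \bar R :=
  ereal_sup [set h | exists (eps : R) (Omega : set A),
    [/\ 0 < eps, finite_set Omega
      & h = limn_esup (fun n =>
              ((n%:R^-1)%:E * lne (rcp (iterates gamma Omega n) eps))%E)]].

End Entropy.

Section Cuntz.
Variables (R : realType) (N : nat) (A : cstarType R) (s : 'I_N -> A).

Definition closed_star_subalgebra (B : set A) : Prop :=
  [/\ forall (x : nat -> A) l, (forall n, B (x n)) ->
        (fun n => cnorm (x n - l)) @ \oo --> (0 : R) -> B l,
      B 0 /\ (forall x y, B x -> B y -> B (x + y)),
      forall (a : R[i]) x, B x -> B (a *: x),
      forall x y, B x -> B y -> B (x * y)
    & forall x, B x -> B (star x)].

(* A is the Cuntz algebra O_N with generating isometries s_1, ..., s_N. *)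
Definition is_cuntz_algebra : Prop :=
  [/\ forall i j, star (s i) * s j = (i == j)%:R,
      \sum_i s i * star (s i) = 1
    & forall B : set A, closed_star_subalgebra B -> (forall i, B (s i)) ->
        B = setT].

Definition cuntz_word k (J : k.-tuple 'I_N) : A := \prod_(j <- J) s j.

Definition cuntz_F k : set A :=
  [set x | exists c : k.-tuple 'I_N -> k.-tuple 'I_N -> R[i],
     x = \sum_I \sum_J c I J *: (cuntz_word I * star (cuntz_word J))].

(* rho is the unital *-endomorphism rho_u. *)
Definition is_rho (u : A) (rho : {lrmorphism A -> A}) : Prop :=
  (forall x, rho (star x) = star (rho x)) /\ (forall i, rho (s i) = u * s i).

Definition perm_unitary k (sigma : {perm k.-tuple 'I_N}) : A :=
  \sum_J cuntz_word (sigma J) * star (cuntz_word J).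

End Cuntz.

(* Main.v *)
Require Import Defs.
From HB Require Import structures.
From mathcomp Require Import all_boot all_order all_algebra all_fingroup all_field.
From mathcomp Require Import complex ring lra zify.
From mathcomp Require Import all_classical all_reals all_analysis.
Import Order.TTheory GRing.Theory Num.Theory.
Import numFieldNormedType.Exports.

Set Implicit Arguments.
Unset Strict Implicit.
Unset Printing Implicit Defensive.

Local Open Scope classical_set_scope.
Local Open Scope complex_scope.
Local Open Scope ring_scope.

(** Write sw P for the product of the generators along a word P, and wspan p q
for the span of the elements sw P * star (sw Q) with |P| = p and |Q| = q. Since
the s_i s_i^* sum to 1, wspan p q is contained in wspan (p+1) (q+1). With
u in F_k this gives rho (wspan p q) <= wspan (p + k - 1) (q + k - 1): every
application of rho raises the word lengths by k - 1 and preserves the degree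
p - q (wspan_rho).

The approximations come from a window of word lengths [m, m + M). Let omega be
the gauge-invariant state with omega (star (sw I) * sw J) = [I = J]. Compress x
to the matrix (omega (star (sw I) * x * sw J)), where I and J run over all words
with lengths in the window, and map a matrix (X_IJ) back to
1/M * sum X_IJ sw I star (sw J). Both maps are unital and completely positive
(word_down_ucp, word_up_ucp). The composite (fejer m M) acts as a Fejer mean of
the gauge action: on wspan p q with p, q <= m it is multiplication by
(M - |p - q|)^+ / M (fejer_wspan, overlap_ge). The error therefore depends on
the degree and on M, but not on m, and as rho preserves degrees, one fixed M
serves rho^j x for all j, provided that m dominates the word lengths of
rho^j x. These are bounded by l + n (k - 1)
for j <= n, so that the full matrix algebra used has rank at most
M * N^(l + M + n (k - 1)), whose exponential growth rate is (k - 1) log N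
(rcp_rho_le, ht_rho_le).

To pass from the dense algebra of words to all of A, contractivity of rho and of
ucp maps is needed. It rests, as does the positivity of omega, on the square root of 1 - h
for a self-adjoint h of norm < 1 (sqrt1B) and on a feature of Cuntz algebras:
with isometries t1, t2 of orthogonal ranges, a column (y1, y2) is encoded by
the single element t1 y1 + t2 y2, whose norm the C*-identity computes
(isometry_pair). A *-morphism is contractive because a self-adjoint element of
norm < 1 is the real part of a unitary; a ucp map is contractive because
[[1, x], [x^*, 1]] has the form Y^* Y when |x| < 1; and a contractive
unital functional is positive because |1 - y^* y| <= 1 when |y| < 1.

The state omega is built without an extension theorem, as the limit of the
iterates of x |-> 1/N sum s_i^* x s_i, which are contractive and converge to a
scalar on words since N >= 2. *)

(** * Norms and limits in a C*-algebra *)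

Section Norm.
Variables (R : realType) (A : cstarType R).
Implicit Types (x y z : A) (a : R[i]) (r : R).

Lemma star0 : star (0 : A) = 0.
Proof. by apply: (addrI (star 0)); rewrite -starD !addr0. Qed.

Lemma starN x : star (- x) = - star x.
Proof. by apply: (addrI (star x)); rewrite -starD !subrr star0. Qed.

Lemma starB x y : star (x - y) = star x - star y.
Proof. by rewrite starD starN. Qed.

Lemma star1 : star (1 : A) = 1.
Proof. by rewrite -[LHS]mulr1 -{2}[1](starK 1) -starM mulr1 starK. Qed.

Lemma star_sum (I : Type) (r : seq I) (P : pred I) (F : I -> A) :
  star (\sum_(i <- r | P i) F i) = \sum_(i <- r | P i) star (F i).
Proof. exact: (big_morph star starD star0). Qed.

Lemma starZr r x : star (r%:C *: x) = r%:C *: star x.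
Proof. by rewrite starZ conj_Creal // complex_real. Qed.

Lemma cnormZ_real r x : cnorm (r%:C *: x) = `|r| * cnorm x.
Proof.
apply: (@complexI R); rewrite cnormZ rmorphM /=; congr (_ * _).
by rewrite normc_def /= expr0n /= addr0 sqrtr_sqr.
Qed.

Lemma cnorm0 : cnorm (0 : A) = 0.
Proof. by rewrite -(scale0r (0 : A)) -(rmorph0 (real_complex R)) cnormZ_real normr0 mul0r. Qed.

Lemma cnormN x : cnorm (- x) = cnorm x.
Proof. by rewrite -scaleN1r -(rmorphN1 (real_complex R)) cnormZ_real normrN1 mul1r. Qed.

Lemma cnorm_ge0 x : 0 <= cnorm x.
Proof. have := cnormD x (- x); rewrite subrr cnorm0 cnormN; lra. Qed.

Lemma cnorm_distC x y : cnorm (x - y) = cnorm (y - x).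
Proof. by rewrite -opprB cnormN. Qed.

Lemma cnorm_dist_trans y x z : cnorm (x - z) <= cnorm (x - y) + cnorm (y - z).
Proof. by apply: le_trans (cnormD _ _); rewrite addrA subrK. Qed.

Lemma cnorm_sum (I : Type) (r : seq I) (P : pred I) (F : I -> A) :
  cnorm (\sum_(i <- r | P i) F i) <= \sum_(i <- r | P i) cnorm (F i).
Proof.
elim/big_rec2: _ => [|i u v _ h]; first by rewrite cnorm0.
by apply: le_trans (cnormD _ _) _; rewrite lerD2l.
Qed.

Lemma cnorm1 : cnorm (1 : A) = 1.
Proof.
have := cnorm_star (1 : A); rewrite star1 mulr1 => h.
have h0 : cnorm (1 : A) != 0.
  by apply/eqP => /cnorm_eq0 /eqP; rewrite oner_eq0.
by apply: (mulfI h0); rewrite mulr1 {3}h.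
Qed.

Lemma cnorm_starE x : cnorm (star x) = cnorm x.
Proof.
suff le y : cnorm y <= cnorm (star y).
  by apply/eqP; rewrite eq_le le andbT -{2}(starK x) le.
have [->|y0] := eqVneq (cnorm y) 0; first exact: cnorm_ge0.
have y_gt0 : 0 < cnorm y by rewrite lt_def y0 cnorm_ge0.
by rewrite -(ler_pM2r y_gt0) -expr2 -cnorm_star cnormM.
Qed.

Lemma cnorm_le_sq x r : 0 <= r -> cnorm (star x * x) <= r ^+ 2 -> cnorm x <= r.
Proof. by move=> r0; rewrite cnorm_star ler_sqr ?nnegrE ?cnorm_ge0. Qed.

Lemma isometry_norm x : star x * x = 1 -> cnorm x <= 1.
Proof. by move=> h; apply: cnorm_le_sq => //; rewrite h cnorm1 expr1n. Qed.

Lemma cnormM_le x y r1 r2 :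
  cnorm x <= r1 -> cnorm y <= r2 -> cnorm (x * y) <= r1 * r2.
Proof. by move=> h1 h2; apply: le_trans (cnormM _ _) _; apply: ler_pM; rewrite ?cnorm_ge0. Qed.

Lemma cnormM_le1 x y : cnorm x <= 1 -> cnorm y <= 1 -> cnorm (x * y) <= 1.
Proof. by move=> h1 h2; have := cnormM_le h1 h2; rewrite mulr1. Qed.

Definition nlim (x : nat -> A) (l : A) : Prop :=
  forall eps : R, 0 < eps -> exists n0, forall n, (n0 <= n)%N -> cnorm (x n - l) < eps.

Lemma nlimP (x : nat -> A) l :
  nlim x l <-> (fun n => cnorm (x n - l)) @ \oo --> (0 : R).
Proof.
split=> [h|/cvgrPdist_lt h eps e0].
  apply/cvgrPdist_lt => eps e0; have [n0 hn0] := h _ e0.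
  exists n0 => // n /= /hn0; by rewrite sub0r normrN ger0_norm ?cnorm_ge0.
have [n0 _ hn0] := h _ e0; exists n0 => n /hn0 /=.
by rewrite sub0r normrN ger0_norm ?cnorm_ge0.
Qed.

Lemma nlimD (x y : nat -> A) l k :
  nlim x l -> nlim y k -> nlim (fun n => x n + y n) (l + k).
Proof.
move=> hx hy e e0; have e2 : 0 < e / 2 by rewrite divr_gt0.
have [n0 h0] := hx _ e2; have [n1 h1] := hy _ e2; exists (maxn n0 n1) => n.
rewrite geq_max => /andP[/h0 {}h0 /h1 {}h1].
rewrite opprD addrACA; apply: le_lt_trans (cnormD _ _) _; lra.
Qed.

Lemma nlim_lip (f : A -> A) (K : R) (x : nat -> A) l :
  (forall u v, cnorm (f u - f v) <= K * cnorm (u - v)) ->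
  nlim x l -> nlim (fun n => f (x n)) (f l).
Proof.
move=> fK h e e0; have K1 : 0 < `|K| + 1 by rewrite ltr_wpDl.
have [n0 h0] := h _ (divr_gt0 e0 K1); exists n0 => n /h0.
rewrite ltr_pdivlMr // => hn; apply: le_lt_trans hn; apply: le_trans (fK _ _) _.
rewrite mulrC ler_wpM2l ?cnorm_ge0 //; have := ler_norm K; lra.
Qed.

Lemma nlimM (x y : nat -> A) l k :
  nlim x l -> nlim y k -> nlim (fun n => x n * y n) (l * k).
Proof.
move=> hx hy e e0.
have K1 : 0 < cnorm l + cnorm k + 1 by rewrite ltr_wpDl ?addr_ge0 ?cnorm_ge0.
set d := Num.min 1 (e / (cnorm l + cnorm k + 1)).
have d0 : 0 < d by rewrite lt_min ltr01 divr_gt0.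
have [n0 h0] := hx _ d0; have [n1 h1] := hy _ d0; exists (maxn n0 n1) => n.
rewrite geq_max => /andP[/h0 {}h0 /h1 {}h1].
have -> : x n * y n - l * k = (x n - l) * (y n - k) + ((x n - l) * k + l * (y n - k)).
  by rewrite addrA -mulrDr subrK mulrBl mulrBr addrA subrK.
have d1 : d <= 1 by rewrite ge_min lexx.
have dK : d * (cnorm l + cnorm k + 1) <= e.
  by rewrite -ler_pdivlMr // ge_min lexx orbT.
have n1' := cnormM (x n - l) (y n - k).
have n2' := cnormM (x n - l) k.
have n3' := cnormM l (y n - k).
have t1 := cnormD ((x n - l) * (y n - k)) ((x n - l) * k + l * (y n - k)).
have t2 := cnormD ((x n - l) * k) (l * (y n - k)).
have := cnorm_ge0 (x n - l); have := cnorm_ge0 (y n - k).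
have := cnorm_ge0 l; have := cnorm_ge0 k.
nra.
Qed.

Lemma nlim_star (x : nat -> A) l : nlim x l -> nlim (fun n => star (x n)) (star l).
Proof.
by move=> h e /h[n0 h0]; exists n0 => n /h0; rewrite -starB cnorm_starE.
Qed.

Lemma nlim_uniq (x : nat -> A) l k : nlim x l -> nlim x k -> l = k.
Proof.
move=> hl hk; apply/eqP; rewrite -subr_eq0; apply/eqP/cnorm_eq0/eqP.
rewrite eq_le cnorm_ge0 andbT; apply/ler_addgt0Pr => e e0; rewrite add0r.
have e2 : 0 < e / 2 by rewrite divr_gt0.
have [n0 h0] := hl _ e2; have [n1 h1] := hk _ e2.
have := h0 _ (leq_maxl n0 n1); have := h1 _ (leq_maxr n0 n1).
have := cnorm_dist_trans (x (maxn n0 n1)) l k.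
rewrite [cnorm (l - x _)]cnorm_distC; lra.
Qed.

Lemma nlim_eq (x : nat -> A) l : (forall n, x n = l) -> nlim x l.
Proof. by move=> h e e0; exists 0%N => n _; rewrite h subrr cnorm0. Qed.

Lemma nlim_norm_le (x : nat -> A) l r : nlim x l -> (forall n, cnorm (x n) <= r) -> cnorm l <= r.
Proof.
move=> h hr; apply/ler_addgt0Pr => e /h[n0 h0].
have := h0 _ (leqnn _); have := hr n0; have := cnormD (x n0) (l - x n0).
rewrite [in cnorm (l - _)]cnorm_distC addrC subrK; lra.
Qed.

End Norm.
(** * Square roots and automatic contractivity *)

Section SquareRoot.
Variables (R : realType) (A : cstarType R).
Implicit Types (x y h : A).

(** With b = 1 - w, the equation b^2 = 1 - h reads w = (h + w^2) / 2; this is the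
fixed point iteration for w. It is a contraction of ratio |h| on the ball of
radius |h|. *)
Fixpoint sqrt_iter h n : A :=
  if n is n'.+1 then (2^-1)%:C *: (h + sqrt_iter h n' * sqrt_iter h n') else 0.

Lemma sqrt_iter_le h n : cnorm h < 1 -> cnorm (sqrt_iter h n) <= cnorm h.
Proof.
move=> h1; elim: n => [|n IH] /=; first by rewrite cnorm0 cnorm_ge0.
rewrite cnormZ_real ger0_norm ?invr_ge0 //.
have := cnormD h (sqrt_iter h n * sqrt_iter h n); have := cnormM_le IH IH.
have := cnorm_ge0 h; nra.
Qed.

Lemma sqrt_iter_step h n : cnorm h < 1 ->
  cnorm (sqrt_iter h n.+1 - sqrt_iter h n) <= cnorm h ^+ n.
Proof.
move=> h1; have h0 := cnorm_ge0 h; elim: n => [|n IH].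
  by rewrite subr0 expr0; apply: le_trans (sqrt_iter_le _ h1) (ltW h1).
have -> : sqrt_iter h n.+2 - sqrt_iter h n.+1 =
    (2^-1)%:C *: (sqrt_iter h n.+1 * (sqrt_iter h n.+1 - sqrt_iter h n)
                  + (sqrt_iter h n.+1 - sqrt_iter h n) * sqrt_iter h n).
  rewrite mulrBr mulrBl addrA subrK [LHS]/= -[sqrt_iter h n.+1]/(sqrt_iter h n.+1).
  by rewrite -!scalerBr opprD addrACA subrr add0r.
rewrite cnormZ_real ger0_norm ?invr_ge0 //.
have b1 := cnormM_le (sqrt_iter_le n.+1 h1) IH.
have b2 := cnormM_le IH (sqrt_iter_le n h1).
have := cnormD (sqrt_iter h n.+1 * (sqrt_iter h n.+1 - sqrt_iter h n))
               ((sqrt_iter h n.+1 - sqrt_iter h n) * sqrt_iter h n).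
rewrite exprS; lra.
Qed.

Lemma sqrt_iter_tail h n m : cnorm h < 1 ->
  cnorm (sqrt_iter h (n + m) - sqrt_iter h n) <= cnorm h ^+ n / (1 - cnorm h).
Proof.
move=> h1; have h0 := cnorm_ge0 h; have h2 : 0 < 1 - cnorm h by lra.
rewrite ler_pdivlMr //.
suff : cnorm (sqrt_iter h (n + m) - sqrt_iter h n) * (1 - cnorm h)
     <= cnorm h ^+ n - cnorm h ^+ (n + m).
  have : 0 <= cnorm h ^+ (n + m) by rewrite exprn_ge0. lra.
elim: m => [|m IH]; first by rewrite addn0 !subrr cnorm0 mul0r.
have := sqrt_iter_step (n + m) h1.
have := cnorm_dist_trans (sqrt_iter h (n + m)) (sqrt_iter h (n + m.+1)) (sqrt_iter h n).
rewrite addnS exprS; move: IH; set p := cnorm h ^+ (n + m).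
have : 0 <= p by rewrite exprn_ge0.
nra.
Qed.

Lemma sqrt1B h : star h = h -> cnorm h < 1 ->
  exists b : A, [/\ star b = b, b * b = 1 - h & forall x, x * h = h * x -> x * b = b * x].
Proof.
move=> hs h1; have h0 := cnorm_ge0 h.
have [w wl] : exists l, nlim (sqrt_iter h) l.
  have [e e0|l /nlimP hl] := @cnorm_complete R A (sqrt_iter h); last by exists l.
  have e2 : 0 < e / 2 * (1 - cnorm h) by rewrite mulr_gt0 ?divr_gt0 ?subr_gt0.
  have : (GRing.exp (cnorm h)) @ \oo --> (0 : R) by apply: cvg_expr; rewrite ger0_norm.
  move=> /cvgrPdist_lt /(_ _ e2) [n0 _ hn0].
  have key n : (n0 <= n)%N -> cnorm (sqrt_iter h n - sqrt_iter h n0) < e / 2.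
    move=> hn; rewrite -(subnKC hn); apply: le_lt_trans (sqrt_iter_tail _ _ h1) _.
    rewrite ltr_pdivrMr ?subr_gt0 //; have := hn0 n0 (leqnn _).
    by rewrite sub0r normrN ger0_norm // exprn_ge0.
  exists n0 => m n /key hm /key hn.
  have := cnorm_dist_trans (sqrt_iter h n0) (sqrt_iter h m) (sqrt_iter h n).
  rewrite [cnorm (sqrt_iter h n0 - _)]cnorm_distC; lra.
have weq : w = (2^-1)%:C *: (h + w * w).
  apply: (@nlim_uniq _ _ (fun n => sqrt_iter h n.+1)).
    by move=> e /wl[n0 hn0]; exists n0 => n hn; apply: hn0; rewrite leqW.
  apply: (@nlim_lip _ _ (fun z => (2^-1)%:C *: (h + z)) 1 (fun n => sqrt_iter h n * sqrt_iter h n)).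
    move=> u v; rewrite -scalerBr opprD addrACA subrr add0r cnormZ_real.
    rewrite ger0_norm ?invr_ge0 // ler_wpM2r ?cnorm_ge0 //; lra.
  exact: nlimM.
have ws : star w = w.
  apply: (nlim_uniq (nlim_star wl)); move=> e /wl[n0 hn0]; exists n0 => n.
  suff -> : star (sqrt_iter h n) = sqrt_iter h n by apply: hn0.
  elim: n => [|n IH] /=; first exact: star0.
  by rewrite starZr starD starM hs !IH.
exists (1 - w); split; first by rewrite starB star1 ws.
  have : h + w * w = w + w.
    rewrite {3 4}weq -scalerDl -rmorphD /=.
    by rewrite (_ : 2^-1 + 2^-1 = 1 :> R) ?scale1r //; field.
  move=> e; have {}e : w * w = w + w - h by rewrite -e addrC addKr.
  by rewrite mulrBr mulr1 mulrBl mul1r opprB e (addrAC (w + w)) addrK addrA subrK.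
move=> x xh; rewrite mulrBr mulrBl mulr1 mul1r; congr (_ - _).
apply: (@nlim_uniq _ _ (fun n => x * sqrt_iter h n)).
  by apply: nlimM => //; apply: nlim_eq.
suff e n : x * sqrt_iter h n = sqrt_iter h n * x.
  move=> eps e0; have [n0 hn0] := nlimM wl (nlim_eq (fun=> erefl x)) e0.
  by exists n0 => n hn; rewrite e hn0.
elim: n => [|n IH] /=; first by rewrite mulr0 mul0r.
by rewrite -scalerAl -scalerAr mulrDr mulrDl xh mulrA IH -!mulrA IH.
Qed.

End SquareRoot.

Section Contraction.
Variables (R : realType) (A B : cstarType R).

Lemma cnorm_lt_le (f : A -> B) :
  (forall (c : R[i]) x, f (c *: x) = c *: f x) ->
  (forall x, cnorm x < 1 -> cnorm (f x) <= 1) ->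
  forall x, cnorm (f x) <= cnorm x.
Proof.
move=> fZ f1 x; apply/ler_addgt0Pr => e e0.
have K0 : 0 < cnorm x + e by rewrite ltr_wpDl ?cnorm_ge0.
have := f1 ((cnorm x + e)^-1%:C *: x); rewrite fZ !cnormZ_real.
rewrite ger0_norm ?invr_ge0 ?(ltW K0) // mulrC ltr_pdivrMr // mul1r ltrDl => /(_ e0).
by rewrite mulrC ler_pdivrMr // mul1r.
Qed.

End Contraction.
Section StarMorphism.
Variables (R : realType) (A B : cstarType R) (f : {lrmorphism A -> B}).
Hypothesis f_star : forall x, f (star x) = star (f x).

(** A self-adjoint a with |a| < 1 is the real part of the unitary a + i b, where
b^2 = 1 - a^2, and a *-morphism maps unitaries to unitaries. The C*-identity
reduces the general case to this one. *)
Lemma star_morph_contractive x : cnorm (f x) <= cnorm x.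
Proof.
suff sa (a : A) : star a = a -> cnorm a < 1 -> cnorm (f a) <= 1.
  apply: (cnorm_lt_le (f := f)) => [c y|y y1]; first exact: linearZ.
  apply: cnorm_le_sq => //; rewrite -f_star -rmorphM expr1n; apply: sa.
    by rewrite starM starK.
  by rewrite cnorm_star expr_lt1 ?cnorm_ge0.
move=> as_ a1; have a20 : cnorm (a * a) < 1.
  by rewrite -{1}as_ cnorm_star expr_lt1 ?cnorm_ge0.
have [|b [bs b2 bC]] := sqrt1B (h := a * a) _ a20; first by rewrite starM as_.
have ab : a * b = b * a by apply: bC; rewrite mulrA.
have ii : 'i * 'i = -1 :> R[i] by rewrite -expr2 sqrCi.
(* The unitary whose real part is a. *)
pose z := a + 'i *: b; have zs : star z = a - 'i *: b.
  by rewrite /z starD starZ as_ bs conjCi scaleNr.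
have zz : star z * z = 1.
  rewrite zs /z mulrDr !mulrBl -!scalerAr -!scalerAl scalerA ii scaleN1r ab b2.
  by rewrite opprK addrA subrK addrC subrK.
have fz : cnorm (f z) <= 1 by apply: isometry_norm; rewrite -f_star -rmorphM zz rmorph1.
have fz' : cnorm (f (star z)) <= 1 by rewrite f_star cnorm_starE.
have -> : a = (2^-1)%:C *: (z + star z).
  rewrite zs /z addrACA subrr addr0 scalerDr -scalerDl -rmorphD /=.
  by rewrite (_ : 2^-1 + 2^-1 = 1 :> R) ?scale1r //; field.
rewrite linearZ /= cnormZ_real ger0_norm ?invr_ge0 // linearD.
have := cnormD (f z) (f (star z)); lra.
Qed.

End StarMorphism.

Section CompletelyPositiveContraction.
Variables (R : realType) (A B : cstarType R).

(** The column (y1, y2) is represented inside B by t1 y1 + t2 y2, so that the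
C*-identity and submultiplicativity of B apply to columns. *)
Lemma isometry_pair (t1 t2 y1 y2 z1 z2 : B) :
  star t1 * t1 = 1 -> star t2 * t2 = 1 -> star t1 * t2 = 0 ->
  star (t1 * y1 + t2 * y2) * (t1 * z1 + t2 * z2) = star y1 * z1 + star y2 * z2.
Proof.
move=> h1 h2 h12; have h21 : star t2 * t1 = 0.
  by rewrite -(starK t1) -starM h12 star0.
rewrite starD !starM mulrDr !mulrDl !mulrA -!(mulrA (star _) (star _)).
by rewrite h1 h2 h12 h21 !mulr0 !mul0r !mulr1 addr0 add0r.
Qed.

(** For |x| < 1 the matrix [[1, x], [x^*, 1]] is positive. Its image is then Z^* Z,
which exhibits f x as the product P^* Q of two isometries, the encodings of
the two columns of Z. *)
Lemma ucp_contractive (t1 t2 : B) (f : {linear A -> B}) :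
  star t1 * t1 = 1 -> star t2 * t2 = 1 -> star t1 * t2 = 0 -> ucp f ->
  forall x, cnorm (f x) <= cnorm x.
Proof.
move=> h1 h2 h12 [f1 fcp]; apply: cnorm_lt_le => [c x|x x1]; first exact: linearZ.
have xx : cnorm (star x * x) < 1 by rewrite cnorm_star expr_lt1 ?cnorm_ge0.
have [|b [bs b2 _]] := sqrt1B _ xx; first by rewrite starM starK.
(* Y^* Y = [[1, x], [x^*, x^* x + b^2]] with x^* x + b^2 = 1. *)
pose Y : 'M[A]_2 := \matrix_(i, j) if i == 0 then (if j == 0 then 1 else x)
                                   else (if j == 0 then 0 else b).
have [|Z ZE] := fcp _ (mxstar Y *m Y); first by exists Y.
have e i j : f (star (Y 0 i) * Y 0 j + star (Y 1 i) * Y 1 j)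
    = star (Z 0 i) * Z 0 j + star (Z 1 i) * Z 1 j.
  have := congr1 (fun M : 'M[B]_2 => M i j) ZE.
  by rewrite !mxE !big_ord_recl !big_ord0 !mxE !addr0 /= (_ : lift _ _ = 1) //; apply: val_inj.
have e00 := e 0 0; have e01 := e 0 1; have e11 := e 1 1.
rewrite !mxE /= star0 star1 mulr1 mulr0 addr0 f1 in e00.
rewrite !mxE /= star0 star1 mul1r mul0r addr0 in e01.
rewrite !mxE /= bs b2 addrC subrK f1 in e11.
rewrite e01 -(isometry_pair _ _ _ _ h1 h2 h12).
apply: cnormM_le1; rewrite ?cnorm_starE; apply: isometry_norm.
  by rewrite (isometry_pair _ _ _ _ h1 h2 h12).
by rewrite (isometry_pair _ _ _ _ h1 h2 h12).
Qed.

(** If b^2 = 1 - y^* y, then t1 y + t2 b is an isometry, and b is recovered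
from it by multiplying by t2^*. *)
Lemma cnorm_1B_star (t1 t2 y : B) :
  star t1 * t1 = 1 -> star t2 * t2 = 1 -> star t1 * t2 = 0 ->
  cnorm y < 1 -> cnorm (1 - star y * y) <= 1.
Proof.
move=> h1 h2 h12 y1.
have yy : cnorm (star y * y) < 1 by rewrite cnorm_star expr_lt1 ?cnorm_ge0.
have [|b [bs b2 _]] := sqrt1B _ yy; first by rewrite starM starK.
rewrite -b2 -{1}bs cnorm_star expr_le1 ?cnorm_ge0 //.
have -> : b = star t2 * (t1 * y + t2 * b).
  have h21 : star t2 * t1 = 0 by rewrite -(starK t1) -starM h12 star0.
  by rewrite mulrDr !mulrA h2 h21 mul0r add0r mul1r.
apply: cnormM_le1; first by rewrite cnorm_starE isometry_norm.
by apply: isometry_norm; rewrite (isometry_pair _ _ _ _ h1 h2 h12) bs b2 addrC subrK.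
Qed.

End CompletelyPositiveContraction.
(** * Completeness of the scalars *)

Section ComplexComplete.
Variable R : realType.

Definition cmod (a : R[i]) : R := complex.Re `|a|.

Lemma cmodE a : (cmod a)%:C = `|a|.
Proof. by rewrite /cmod normc_def. Qed.

Lemma cnormZ_cmod a (A : cstarType R) (x : A) : cnorm (a *: x) = cmod a * cnorm x.
Proof. by apply: (@complexI R); rewrite cnormZ rmorphM /= cmodE. Qed.

Lemma real_complete (u : nat -> R) :
  (forall e, 0 < e -> exists n0, forall m n, (n0 <= m)%N -> (n0 <= n)%N -> `|u m - u n| < e) ->
  exists l : R, forall e, 0 < e -> exists n0, forall n, (n0 <= n)%N -> `|u n - l| < e.
Proof.
move=> h.
have /cauchy_cvgP /cvgrPdist_lt hl : cauchy (u @ \oo).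
  apply/cauchy_exP => e e0; have [n0 h0] := h _ e0.
  exists (u n0); exists n0 => // n /= hn; rewrite /ball /= .
  exact: h0.
exists (lim (u @ \oo)) => e /hl [n0 _ hn0]; exists n0 => n hn.
by rewrite distrC; apply: hn0.
Qed.

Lemma cmod_sqrt a : cmod a = Num.sqrt (complex.Re a ^+ 2 + complex.Im a ^+ 2).
Proof. by apply: (@complexI R); rewrite cmodE normc_def. Qed.

Lemma Re_le_cmod a : `|complex.Re a| <= cmod a.
Proof. by rewrite cmod_sqrt -sqrtr_sqr ler_wsqrtr // lerDl sqr_ge0. Qed.

Lemma Im_le_cmod a : `|complex.Im a| <= cmod a.
Proof. by rewrite cmod_sqrt -sqrtr_sqr ler_wsqrtr // lerDr sqr_ge0. Qed.

Lemma cmod_le_Re_Im a : cmod a <= `|complex.Re a| + `|complex.Im a|.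
Proof.
rewrite cmod_sqrt -(ler_sqr (x := Num.sqrt _)) ?nnegrE ?sqrtr_ge0 ?addr_ge0 //.
rewrite sqr_sqrtr ?addr_ge0 ?sqr_ge0 // sqrrD !real_normK ?num_real //.
by rewrite addrAC lerDl mulrn_wge0 // mulr_ge0.
Qed.

Lemma complex_complete (z : nat -> R[i]) :
  (forall e, 0 < e -> exists n0, forall m n, (n0 <= m)%N -> (n0 <= n)%N ->
     cmod (z m - z n) < e) ->
  exists l : R[i], forall e, 0 < e -> exists n0, forall n, (n0 <= n)%N -> cmod (z n - l) < e.
Proof.
move=> h.
have [|x hx] := @real_complete (fun n => complex.Re (z n)).
  move=> e /h[n0 h0]; exists n0 => m n hm hn; rewrite -raddfB.
  exact: le_lt_trans (Re_le_cmod _) (h0 _ _ hm hn).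
have [|y hy] := @real_complete (fun n => complex.Im (z n)).
  move=> e /h[n0 h0]; exists n0 => m n hm hn; rewrite -raddfB.
  exact: le_lt_trans (Im_le_cmod _) (h0 _ _ hm hn).
exists (x +i* y) => e e0; have e2 : 0 < e / 2 by rewrite divr_gt0.
have [n0 h0] := hx _ e2; have [n1 h1] := hy _ e2; exists (maxn n0 n1) => n.
rewrite geq_max => /andP[/h0 {}h0 /h1 {}h1].
apply: le_lt_trans (cmod_le_Re_Im _) _; rewrite !raddfB /=; lra.
Qed.

End ComplexComplete.
(** * Words in the generators and density of their span *)

Section Words.
Variables (R : realType) (N : nat) (A : cstarType R) (s : 'I_N -> A).
Hypothesis hs : is_cuntz_algebra s.
Implicit Types (P Q K w : seq 'I_N) (x y : A) (a : R[i]).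

Lemma ss i j : star (s i) * s j = (i == j)%:R.
Proof. by case: hs. Qed.

Lemma sum_ss : \sum_i s i * star (s i) = 1.
Proof. by case: hs. Qed.

(** The same product as cuntz_word, on lists, so that words of different
lengths live in one type. *)
Definition sw w : A := \prod_(j <- w) s j.

Lemma sw_nil : sw [::] = 1.
Proof. exact: big_nil. Qed.

Lemma sw_cons i w : sw (i :: w) = s i * sw w.
Proof. exact: big_cons. Qed.

Lemma sw_cat w1 w2 : sw (w1 ++ w2) = sw w1 * sw w2.
Proof. exact: big_cat. Qed.

Lemma sw_rcons w i : sw (rcons w i) = sw w * s i.
Proof. by rewrite -cats1 sw_cat sw_cons sw_nil mulr1. Qed.

Lemma star_sw_cons i j P Q :
  star (sw (i :: P)) * sw (j :: Q) = (i == j)%:R *: (star (sw P) * sw Q).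
Proof.
rewrite !sw_cons starM mulrA -(mulrA _ (star (s i))) ss.
by case: eqP => _; rewrite ?mulr1 ?scale1r // mulr0 mul0r scale0r.
Qed.

Lemma star_sw P Q : size P = size Q -> star (sw P) * sw Q = (P == Q)%:R.
Proof.
elim: P Q => [|i P IH] [|j Q] //=; first by rewrite sw_nil star1 mulr1.
move=> [/IH e]; rewrite star_sw_cons e eqseq_cons.
by case: eqP => _; rewrite ?scale1r // scale0r.
Qed.

Fixpoint words n : seq (seq 'I_N) :=
  if n is n'.+1 then [seq i :: w | i <- enum 'I_N, w <- words n'] else [:: [::]].

Lemma sum_wordsS (V : zmodType) (F : seq 'I_N -> V) n :
  \sum_(w <- words n.+1) F w = \sum_i \sum_(w <- words n) F (i :: w).
Proof. by rewrite /= big_allpairs_dep /= big_enum. Qed.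

Lemma size_words n : size (words n) = (N ^ n)%N.
Proof. by elim: n => //= n IH; rewrite size_allpairs IH size_enum_ord expnS. Qed.

Lemma mem_words n w : (w \in words n) = (size w == n).
Proof.
elim: n w => [|n IH] [|i w] //=.
  by apply/allpairsP => -[[j v] [_ _ //]].
rewrite eqSS -IH; apply/allpairsP/idP => [[[j v] /= [_ h [_ ->]]]|h] //.
by exists (i, w); rewrite mem_enum.
Qed.

Lemma uniq_words n : uniq (words n).
Proof.
elim: n => //= n IH; apply: allpairs_uniq => //; first exact: enum_uniq.
by move=> [i v] [j w] _ _ /= [-> ->].
Qed.

Lemma sum_words_range n : \sum_(w <- words n) sw w * star (sw w) = 1.
Proof.
elim: n => [|n IH]; first by rewrite big_seq1 sw_nil star1 mulr1.
rewrite sum_wordsS -[RHS]sum_ss; apply: eq_bigr => i _.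
rewrite -[X in _ = X * _](mulr1 (s i)) -IH mulr_sumr mulr_suml; apply: eq_bigr => w _.
by rewrite sw_cons starM !mulrA.
Qed.

(** As an inductive predicate, so that linear statements reduce to a single
pair of words. *)
Inductive wspan p q : A -> Prop :=
| wspan0 : wspan p q 0
| wspanD a P Q x : size P = p -> size Q = q -> wspan p q x ->
    wspan p q (a *: (sw P * star (sw Q)) + x).

Lemma wspan_word P Q : wspan (size P) (size Q) (sw P * star (sw Q)).
Proof. by rewrite -[_ * _]addr0 -[_ * _]scale1r; apply: wspanD => //; apply: wspan0. Qed.

Lemma wspan_add p q x y : wspan p q x -> wspan p q y -> wspan p q (x + y).
Proof.
move=> hx hy; elim: hx => [|a P Q z hP hQ _ IH]; first by rewrite add0r.
by rewrite -addrA; apply: wspanD.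
Qed.

Lemma wspan_scale p q a x : wspan p q x -> wspan p q (a *: x).
Proof.
elim=> [|b P Q z hP hQ _ IH]; first by rewrite scaler0; apply: wspan0.
by rewrite scalerDr scalerA; apply: wspanD.
Qed.

Lemma wspan_sum p q (I : Type) (r : seq I) (F : I -> A) :
  (forall i, wspan p q (F i)) -> wspan p q (\sum_(i <- r) F i).
Proof.
move=> h; elim/big_rec: _ => [|i x _ hx]; first exact: wspan0.
exact: wspan_add.
Qed.

Lemma wspan_star p q x : wspan p q x -> wspan q p (star x).
Proof.
elim=> [|a P Q z hP hQ _ IH]; first by rewrite star0; apply: wspan0.
by rewrite starD starZ starM starK; apply: wspanD.
Qed.

(** Insert sum s_i s_i^* = 1 between sw P and star (sw Q). *)
Lemma wspanS p q x : wspan p q x -> wspan p.+1 q.+1 x.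
Proof.
elim=> [|a P Q z hP hQ _ IH]; first exact: wspan0.
apply: wspan_add => //; apply: wspan_scale.
have -> : sw P * star (sw Q) = \sum_i sw (rcons P i) * star (sw (rcons Q i)).
  rewrite -{1}(mulr1 (sw P)) -sum_ss mulr_sumr mulr_suml; apply: eq_bigr => i _.
  by rewrite !sw_rcons starM !mulrA.
apply: wspan_sum => i; rewrite -hP -hQ -(size_rcons P i) -(size_rcons Q i).
exact: wspan_word.
Qed.

Lemma wspan_lift n p q x : wspan p q x -> wspan (p + n) (q + n) x.
Proof. by move=> h; elim: n => [|n IH]; rewrite ?addn0 // !addnS; apply: wspanS. Qed.

Lemma wspan_mul p q r x y : wspan p q x -> wspan q r y -> wspan p r (x * y).
Proof.
move=> hx hy; elim: hx => [|a P Q z hP hQ _ IH]; first by rewrite mul0r; apply: wspan0.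
rewrite mulrDl; apply: wspan_add => //; rewrite -scalerAl; apply: wspan_scale.
elim: hy => [|b P' Q' y' hP' hQ' _ IH']; first by rewrite mulr0; apply: wspan0.
rewrite mulrDr; apply: wspan_add => //; rewrite -scalerAr; apply: wspan_scale.
rewrite mulrA -(mulrA (sw P)) star_sw ?hQ ?hP' //; case: eqP => _.
  by rewrite mulr1 -hP -hQ'; apply: wspan_word.
by rewrite mulr0 mul0r; apply: wspan0.
Qed.

Lemma wspan_mul_lift p q p' q' x y :
  wspan p q x -> wspan p' q' y -> wspan (p + p') (q' + q) (x * y).
Proof.
move=> /(wspan_lift p') hx /(wspan_lift q) hy.
by apply: wspan_mul hx _; rewrite addnC.
Qed.

Inductive wpoly : A -> Prop :=
| wpoly_span p q x : wspan p q x -> wpoly x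
| wpoly_add x y : wpoly x -> wpoly y -> wpoly (x + y).

Lemma wpoly_scale a x : wpoly x -> wpoly (a *: x).
Proof.
elim=> [p q {}x hx|{}x y _ hx _ hy]; first by apply: wpoly_span (wspan_scale a hx).
by rewrite scalerDr; apply: wpoly_add.
Qed.

Lemma wpoly_star x : wpoly x -> wpoly (star x).
Proof.
elim=> [p q {}x hx|{}x y _ hx _ hy]; first by apply: wpoly_span (wspan_star hx).
by rewrite starD; apply: wpoly_add.
Qed.

Lemma wpoly_mul x y : wpoly x -> wpoly y -> wpoly (x * y).
Proof.
move=> hx hy; elim: hx => [p q {}x hx|x1 x2 _ h1 _ h2]; last first.
  by rewrite mulrDl; apply: wpoly_add.
elim: hy => [p' q' {}y hy|y1 y2 _ h1 _ h2]; last first.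
  by rewrite mulrDr; apply: wpoly_add.
by apply: wpoly_span (wspan_mul_lift hx hy).
Qed.

Lemma approx_nlim (P : A -> Prop) x :
  (forall e, 0 < e -> exists2 y, P y & cnorm (y - x) < e) <->
  exists2 u : nat -> A, (forall n, P (u n)) & nlim u x.
Proof.
split=> [h|[u Pu /= ux] e /ux[n hn]]; last by exists (u n) => //; apply: hn.
have h' n : exists y, P y /\ cnorm (y - x) < n.+1%:R^-1.
  by have [|y] := h n.+1%:R^-1; [rewrite invr_gt0 | exists y].
have [u hu] := choice h'; exists u => [n|e e0]; first by case: (hu n).
have : (fun n => n.+1%:R^-1) @ \oo --> (0 : R) by apply: cvg_harmonic.
move=> /cvgrPdist_lt /(_ _ e0) [n0 _ hn0]; exists n0 => n hn.
have [_ /lt_trans -> //] := hu n; have := hn0 n hn.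
by rewrite sub0r normrN ger0_norm // invr_ge0.
Qed.

Lemma wpoly_dense x e : 0 < e -> exists2 y, wpoly y & cnorm (y - x) < e.
Proof.
move: x e; pose B : set A := [set x | forall e, 0 < e -> exists2 y, wpoly y & cnorm (y - x) < e].
suff BT : B = setT by move=> x; have : B x by rewrite BT.
have polyB x : wpoly x -> B x by exists x => //; rewrite subrr cnorm0.
case: hs => _ _; apply; last first.
  move=> i; apply: polyB; apply: (@wpoly_span 1 0).
  have := @wspan_word [:: i] [::].
  by rewrite sw_cons sw_nil star1 !mulr1.
split.
- move=> u l uB /nlimP ul e e0; have e2 : 0 < e / 2 by rewrite divr_gt0.
  have [n0 hn0] := ul _ e2; have [y hy hyu] := uB n0 _ e2; exists y => //.
  have := cnorm_dist_trans (u n0) y l; have := hn0 _ (leqnn _); lra.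
- split; first by apply/polyB/(@wpoly_span 0 0)/wspan0.
  move=> x y /approx_nlim[u up ux] /approx_nlim[v vp vy]; apply/approx_nlim.
  by exists (fun n => u n + v n); [move=> n; apply: wpoly_add | apply: nlimD].
- move=> a x /approx_nlim[u up ux]; apply/approx_nlim.
  exists (fun n => a *: u n) => [n|]; first exact: wpoly_scale.
  by apply: (nlim_lip (K := cmod a)) ux => y z; rewrite -scalerBr cnormZ_cmod.
- move=> x y /approx_nlim[u up ux] /approx_nlim[v vp vy]; apply/approx_nlim.
  by exists (fun n => u n * v n); [move=> n; apply: wpoly_mul | apply: nlimM].
- move=> x /approx_nlim[u up ux]; apply/approx_nlim.
  by exists (fun n => star (u n)); [move=> n; apply: wpoly_star | apply: nlim_star].
Qed.

End Words.
(** * The gauge-invariant state *)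

Section Mean.
Variables (R : realType) (N : nat) (A : cstarType R) (s : 'I_N -> A).
Hypothesis N2 : (2 <= N)%N.
Hypothesis hs : is_cuntz_algebra s.
Implicit Types (P Q K w : seq 'I_N) (x y : A) (a : R[i]).
Local Notation sw := (sw s).

(** Compression removes one letter at both ends of sw P * star (sw Q). Its
iterates converge to the scalar omega x: once one of the words is exhausted, a
scalar or a nonempty word remains; scalars are fixed, and the norm of a
nonempty word or of its adjoint is divided by N at every further step. *)
Definition compress x : A := (N%:R^-1)%:C *: \sum_i star (s i) * x * s i.

Lemma NR_neq0 : N%:R != 0 :> R.
Proof. by rewrite pnatr_eq0 -lt0n ltnW. Qed.

Lemma isometry_s i : star (s i) * s i = 1.
Proof. by rewrite (ss hs) eqxx. Qed.

Lemma compressD x y : compress (x + y) = compress x + compress y.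
Proof.
rewrite /compress -scalerDr -big_split /=; congr (_ *: _).
by apply: eq_bigr => i _; rewrite mulrDr mulrDl.
Qed.

Lemma compressZ a x : compress (a *: x) = a *: compress x.
Proof.
rewrite /compress scalerA mulrC -scalerA; congr (_ *: _); rewrite scaler_sumr.
by apply: eq_bigr => i _; rewrite -scalerAr -scalerAl.
Qed.

Lemma compress_star x : compress (star x) = star (compress x).
Proof.
rewrite /compress starZr star_sum; congr (_ *: _).
by apply: eq_bigr => i _; rewrite !starM starK mulrA.
Qed.

Lemma compress_scalar a : compress (a *: 1) = a *: 1.
Proof.
rewrite compressZ; congr (_ *: _); rewrite /compress.
under eq_bigr do rewrite mulr1 isometry_s.
rewrite sumr_const card_ord (_ : 1 *+ N = N%:R%:C *: 1 :> A).
  by rewrite scalerA -rmorphM /= mulVf ?NR_neq0 // scale1r.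
by rewrite (rmorph_nat (real_complex R)) scaler_nat.
Qed.

Lemma compress_contractive x : cnorm (compress x) <= cnorm x.
Proof.
rewrite /compress cnormZ_real ger0_norm ?invr_ge0 //.
rewrite ler_pdivrMl; last by rewrite ltr0n ltnW.
apply: le_trans (cnorm_sum _ _ _) _.
apply: (@le_trans _ _ (\sum_(i < N) cnorm x)); last by rewrite sumr_const card_ord mulr_natl.
apply: ler_sum => i _; have s1 := isometry_norm (isometry_s i).
apply: le_trans (cnormM _ _) _; rewrite -[leRHS]mulr1.
apply: ler_pM; rewrite ?cnorm_ge0 //.
apply: le_trans (cnormM _ _) _; rewrite -[leRHS]mul1r.
by apply: ler_pM; rewrite ?cnorm_ge0 ?cnorm_starE.
Qed.

Definition has_mean x a : Prop := nlim (fun n => iter n compress x) (a *: 1).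

Lemma has_meanD x y a b : has_mean x a -> has_mean y b -> has_mean (x + y) (a + b).
Proof.
move=> hx hy; have := nlimD hx hy; rewrite -scalerDl.
move=> h e /h[n0 hn0]; exists n0 => n /hn0.
suff -> : iter n compress (x + y) = iter n compress x + iter n compress y by [].
by elim: n => //= n ->; rewrite compressD.
Qed.

Lemma has_meanZ b x a : has_mean x a -> has_mean (b *: x) (b * a).
Proof.
move=> h; rewrite /has_mean -scalerA => e e0.
have [|n0 hn0] := nlim_lip (f := fun z => b *: z) (K := cmod b) _ h e0.
  by move=> y z; rewrite -scalerBr cnormZ_cmod.
exists n0 => n /hn0; suff -> : iter n compress (b *: x) = b *: iter n compress x by [].
by elim: n => //= n ->; rewrite compressZ.
Qed.

Lemma has_mean_star x a : has_mean x a -> has_mean (star x) a^*.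
Proof.
move=> /nlim_star h e /h[n0 hn0]; exists n0 => n /hn0; rewrite starZ star1.
suff -> : iter n compress (star x) = star (iter n compress x) by [].
by elim: n => //= n ->; rewrite compress_star.
Qed.

Lemma has_mean_compress x a : has_mean (compress x) a -> has_mean x a.
Proof.
move=> h e /h[n0 hn0]; exists n0.+1 => -[|n] // /hn0.
by rewrite -iterSr.
Qed.

Lemma has_mean_scalar a : has_mean (a *: 1) a.
Proof. by apply: nlim_eq => n; elim: n => //= n ->; rewrite compress_scalar. Qed.

Lemma cnorm_sw w : cnorm (sw w) <= 1.
Proof. by apply: isometry_norm; rewrite (star_sw hs) // eqxx. Qed.

(** Compression only rotates a word cyclically, up to the factor 1/N. *)
Lemma compress_sw i w : compress (sw (i :: w)) = (N%:R^-1)%:C *: sw (rcons w i).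
Proof.
rewrite /compress; congr (_ *: _); rewrite (bigD1 i) //= big1 ?addr0 => [|j ji].
  by rewrite sw_cons mulrA isometry_s mul1r sw_rcons.
by rewrite sw_cons mulrA (ss hs) (negPf ji) !mul0r.
Qed.

Lemma has_mean_sw w : w != [::] -> has_mean (sw w) 0.
Proof.
move=> w0; have bound n : cnorm (iter n compress (sw w)) <= (N%:R^-1) ^+ n.
  elim: n w w0 => [|n IH] [//|i w] _; first by rewrite expr0 cnorm_sw.
  have iterZ a x : iter n compress (a *: x) = a *: iter n compress x.
    by elim: n {IH} => //= n ->; rewrite compressZ.
  rewrite iterSr compress_sw iterZ cnormZ_real ger0_norm ?invr_ge0 // exprS.
  by rewrite ler_wpM2l ?invr_ge0 // IH // -size_eq0 size_rcons.
have : (GRing.exp (N%:R^-1)) @ \oo --> (0 : R).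
  apply: cvg_expr; rewrite ger0_norm ?invr_ge0 // invf_lt1 ?ltr1n // ltr0n; exact: ltnW.
move=> /cvgrPdist_lt h e /h [n0 _ hn0]; exists n0 => n hn.
rewrite scale0r subr0; apply: le_lt_trans (bound n) _.
by have := hn0 n hn; rewrite sub0r normrN ger0_norm // exprn_ge0 // invr_ge0.
Qed.

Lemma has_mean_star_sw P Q : has_mean (star (sw P) * sw Q) (P == Q)%:R.
Proof.
elim: P Q => [|i P IH] [|j Q].
- by rewrite sw_nil star1 mulr1 -[X in has_mean X](scale1r 1); apply: has_mean_scalar.
- by rewrite sw_nil star1 mul1r; apply: has_mean_sw.
- by rewrite sw_nil mulr1; have := has_mean_star (@has_mean_sw (i :: P) isT); rewrite conjC0.
rewrite (star_sw_cons hs) eqseq_cons.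
have := has_meanZ (i == j)%:R (IH Q).
by case: (i == j); rewrite ?mul1r ?mul0r.
Qed.

Lemma compress_word i j P Q :
  compress (sw (i :: P) * star (sw (j :: Q))) =
  (N%:R^-1)%:C *: ((i == j)%:R *: (sw P * star (sw Q))).
Proof.
rewrite /compress; congr (_ *: _).
under eq_bigr => k _ do
  rewrite !sw_cons starM !mulrA (ss hs) -(mulrA _ (star (s j))) (ss hs).
rewrite (bigD1 i) //= eqxx mul1r big1 ?addr0 => [|k ki]; last first.
  by rewrite (negPf ki) !mul0r.
by rewrite eq_sym; case: eqP => _; rewrite ?mulr1 ?scale1r // mulr0 scale0r.
Qed.

Lemma has_mean_word P Q : exists a, has_mean (sw P * star (sw Q)) a.
Proof.
elim: P Q => [|i P IH] [|j Q].
- by exists 1; have := has_mean_star_sw [::] [::]; rewrite sw_nil star1.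
- exists ((0 : R[i])^* ); rewrite sw_nil mul1r; apply: has_mean_star; exact: has_mean_sw.
- by exists 0; rewrite sw_nil star1 mulr1; apply: has_mean_sw.
have [a ha] := IH Q; eexists; apply: has_mean_compress; rewrite compress_word.
by do 2 apply: has_meanZ; exact: ha.
Qed.

Lemma has_mean_norm x a : has_mean x a -> cmod a <= cnorm x.
Proof.
move=> h; have -> : cmod a = cnorm (a *: (1 : A)) by rewrite cnormZ_cmod cnorm1 mulr1.
apply: nlim_norm_le h _ => n.
by elim: n => //= n; apply: le_trans (compress_contractive _).
Qed.

Lemma has_mean_wpoly x : wpoly s x -> exists a, has_mean x a.
Proof.
elim=> [p q {}x|{}x y _ [a ha] _ [b hb]]; last first.
  by exists (a + b); apply: has_meanD.
elim=> [|c P Q z _ _ _ [a ha]].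
  by exists 0; rewrite -(scale0r 1); apply: has_mean_scalar.
have [b hb] := has_mean_word P Q.
by exists (c * b + a); apply: has_meanD => //; apply: has_meanZ.
Qed.

(** The compressions are contractions, so the means of an approximating sequence
of word polynomials form a Cauchy sequence of scalars. *)
Lemma has_mean_ex x : exists a, has_mean x a.
Proof.
have [u up ux] := (approx_nlim (wpoly s) x).1 (fun e => wpoly_dense hs x (e := e)).
have [z hz] := choice (fun n => has_mean_wpoly (up n)).
have zle m n : cmod (z m - z n) <= cnorm (u m - u n).
  apply: has_mean_norm; rewrite -scaleN1r -[- z n]mulN1r.
  by apply: has_meanD => //; apply: has_meanZ.
have [|a ha] := @complex_complete R z.
  move=> e e0; have e2 : 0 < e / 2 by rewrite divr_gt0.
  have [n0 hn0] := ux _ e2; exists n0 => m n /hn0 hm /hn0 hn.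
  have := zle m n; have := cnorm_dist_trans x (u m) (u n).
  rewrite [cnorm (x - _)]cnorm_distC; lra.
exists a => e e0; have e3 : 0 < e / 3 by rewrite divr_gt0.
have [n1 hn1] := ux _ e3; have [n2 hn2] := ha _ e3.
set k := maxn n1 n2; have [n0 hn0] := hz k _ e3; exists n0 => n /hn0 {}hn0.
have := hn1 k (leq_maxl _ _); have := hn2 k (leq_maxr _ _).
have -> : cmod (z k - a) = cnorm (z k *: 1 - a *: 1 : A).
  by rewrite -scalerBl cnormZ_cmod cnorm1 mulr1.
have : cnorm (iter n compress x - iter n compress (u k)) <= cnorm (u k - x).
  rewrite [leRHS]cnorm_distC.
  elim: n {hn0} => //= n IH; apply: le_trans IH.
  rewrite -scaleN1r -compressZ -compressD scaleN1r; exact: compress_contractive.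
have := cnorm_dist_trans (iter n compress (u k)) (iter n compress x) (a *: 1).
have := cnorm_dist_trans (z k *: 1) (iter n compress (u k)) (a *: 1).
lra.
Qed.

Lemma has_mean_uniq x a b : has_mean x a -> has_mean x b -> a = b.
Proof.
move=> ha hb; have /eqP := nlim_uniq ha hb.
by rewrite -subr_eq0 -scalerBl scaler_eq0 oner_eq0 orbF subr_eq0 => /eqP.
Qed.

Definition omega x : R[i] := projT1 (cid (has_mean_ex x)).

Lemma omegaP x : has_mean x (omega x).
Proof. exact: projT2 (cid (has_mean_ex x)). Qed.

Lemma omegaE x a : has_mean x a -> omega x = a.
Proof. exact: has_mean_uniq (omegaP x). Qed.

Lemma omegaD x y : omega (x + y) = omega x + omega y.
Proof. by apply: omegaE; apply: has_meanD; apply: omegaP. Qed.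

Lemma omegaZ a x : omega (a *: x) = a * omega x.
Proof. by apply: omegaE; apply: has_meanZ; apply: omegaP. Qed.

Lemma omega_star x : omega (star x) = (omega x)^*.
Proof. by apply: omegaE; apply: has_mean_star; apply: omegaP. Qed.

Lemma omega_star_sw P Q : omega (star (sw P) * sw Q) = (P == Q)%:R.
Proof. exact: omegaE (has_mean_star_sw P Q). Qed.

Lemma cmod_omega x : cmod (omega x) <= cnorm x.
Proof. exact: has_mean_norm (omegaP x). Qed.

(** For distinct letters a and b the words a^p b are not prefixes of one another,
hence this sequence of isometries has pairwise orthogonal ranges. *)
Definition shift_iso (p : nat) : A := s (Ordinal (ltnW N2)) ^+ p * s (Ordinal N2).

Lemma star_shift_iso p q : star (shift_iso p) * shift_iso q = (p == q)%:R.
Proof.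
have main m : star (shift_iso 0) * shift_iso m = (0 == m)%:R.
  rewrite /shift_iso expr0 mul1r; case: m => [|m]; first by rewrite mul1r isometry_s.
  by rewrite exprS !mulrA (ss hs) !mul0r.
have ss0 x y : star (s (Ordinal (ltnW N2)) * x) * (s (Ordinal (ltnW N2)) * y) = star x * y.
  by rewrite starM mulrA -(mulrA (star x)) isometry_s mulr1.
elim: p q => [//|p IH] [|q].
  by rewrite -[LHS]starK starM starK main star0.
by rewrite /shift_iso !exprS -!mulrA ss0 IH.
Qed.

(** For |x| < 1 the bound |1 - omega (x^* x)| <= |1 - x^* x| <= 1 forces the real
number omega (x^* x) to be nonnegative. *)
Lemma omega_pos y : 0 <= omega (star y * y).
Proof.
have t0 : star (shift_iso 0) * shift_iso 0 = 1 by rewrite star_shift_iso.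
have t1 : star (shift_iso 1) * shift_iso 1 = 1 by rewrite star_shift_iso.
have t01 : star (shift_iso 0) * shift_iso 1 = 0 by rewrite star_shift_iso.
suff pos x : cnorm x < 1 -> 0 <= omega (star x * x).
  have K0 : 0 < cnorm y + 1 by rewrite ltr_wpDl ?cnorm_ge0.
  have c0 : 0 < ((cnorm y + 1)^-1)%:C :> R[i] by rewrite ltcR invr_gt0.
  have := pos (((cnorm y + 1)^-1)%:C *: y).
  rewrite starZr -scalerAl -scalerAr !omegaZ !pmulr_rge0 //; apply.
  rewrite cnormZ_real ger0_norm ?invr_ge0 ?(ltW K0) // mulrC ltr_pdivrMr // mul1r; lra.
move=> x1; have hr : omega (star x * x) \is Num.real.
  by apply/CrealP; rewrite -omega_star starM starK.
have := le_trans (cmod_omega _) (cnorm_1B_star t0 t1 t01 x1).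
rewrite -scaleN1r omegaD omegaZ mulN1r.
rewrite -(scale1r 1) (omegaE (has_mean_scalar 1)) => h.
have := le_trans (Re_le_cmod _) h.
move: hr => /complex_realP[k ->]; rewrite (_ : 0 = 0%:C) // lecR /=.
by rewrite ler_norml => /andP[_]; lra.
Qed.

End Mean.
(** * Full matrix algebras as C*-algebras *)

Definition orthonormal_isometries (R : realType) (A : cstarType R) (t : nat -> A) :=
  forall p q, star (t p) * t q = (p == q)%:R.

Section MatrixUnits.
Variables (R : realType) (A : cstarType R) (t : nat -> A).
Hypothesis ht : orthonormal_isometries t.
Variable D : nat.
Implicit Types X Y : 'M[R[i]]_D.+1.

Definition cadj X : 'M[R[i]]_D.+1 := \matrix_(a, b) (X b a)^*.

(** The elements t_a t_b^* form a system of matrix units, so this is an injective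
*-morphism (unital only if the t_a t_a^* sum to 1). Pulling back the norm of A
along it makes the matrix algebra a C*-algebra. *)
Definition mxembed X : A := \sum_a \sum_b X a b *: (t a * star (t b)).

Lemma mxembedD X Y : mxembed (X + Y) = mxembed X + mxembed Y.
Proof.
rewrite /mxembed -big_split /=; apply: eq_bigr => a _.
by rewrite -big_split /=; apply: eq_bigr => b _; rewrite mxE scalerDl.
Qed.

Lemma mxembedZ c X : mxembed (c *: X) = c *: mxembed X.
Proof.
rewrite /mxembed scaler_sumr; apply: eq_bigr => a _.
by rewrite scaler_sumr; apply: eq_bigr => b _; rewrite mxE scalerA.
Qed.

Lemma mxembed_star X : mxembed (cadj X) = star (mxembed X).
Proof.
rewrite /mxembed star_sum exchange_big /=; apply: eq_bigr => a _.
by rewrite star_sum; apply: eq_bigr => b _; rewrite mxE starZ starM starK.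
Qed.

Lemma mxembed_t X (b : 'I_D.+1) : mxembed X * t b = \sum_a X a b *: t a.
Proof.
rewrite /mxembed mulr_suml; apply: eq_bigr => a _.
rewrite mulr_suml (bigD1 b) //= big1 ?addr0 => [|c cb].
  by rewrite -scalerAl -mulrA ht eqxx mulr1.
by rewrite -scalerAl -mulrA ht (inj_eq val_inj) (negPf cb) mulr0 scaler0.
Qed.

Lemma mxembed_entry X (a b : 'I_D.+1) : star (t a) * (mxembed X * t b) = X a b *: 1.
Proof.
rewrite mxembed_t mulr_sumr (bigD1 a) //= big1 ?addr0 => [|c ca].
  by rewrite -scalerAr ht eqxx.
by rewrite -scalerAr ht (inj_eq val_inj) eq_sym (negPf ca) scaler0.
Qed.

Lemma mxembedM X Y : mxembed (X * Y) = mxembed X * mxembed Y.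
Proof.
rewrite [in RHS]/mxembed mulr_sumr /mxembed.
under [RHS]eq_bigr => c _.
  rewrite mulr_sumr.
  under eq_bigr => b _ do
    rewrite -scalerAr mulrA mxembed_t mulr_suml scaler_sumr.
  rewrite exchange_big; over.
rewrite [RHS]exchange_big /=; apply: eq_bigr => a _.
rewrite exchange_big /=; apply: eq_bigr => b _.
rewrite !mxE scaler_suml; apply: eq_bigr => c _.
by rewrite -scalerAl scalerA mulrC.
Qed.

Lemma isometry_family_norm p : cnorm (t p) <= 1.
Proof. by apply: isometry_norm; rewrite ht eqxx. Qed.

Lemma cmod_entry_le X a b : cmod (X a b) <= cnorm (mxembed X).
Proof.
have -> : cmod (X a b) = cnorm (star (t a) * (mxembed X * t b)).
  by rewrite mxembed_entry cnormZ_cmod cnorm1 mulr1.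
have ta := isometry_family_norm a; have tb := isometry_family_norm b.
have h1 := cnormM_le (lexx (cnorm (mxembed X))) tb; rewrite mulr1 in h1.
have := cnormM_le (x := star (t a)) (r1 := 1) _ h1; rewrite mul1r; apply.
by rewrite cnorm_starE.
Qed.

Lemma mxembed_norm_le X : cnorm (mxembed X) <= \sum_a \sum_b cmod (X a b).
Proof.
apply: le_trans (cnorm_sum _ _ _) _; apply: ler_sum => a _.
apply: le_trans (cnorm_sum _ _ _) _; apply: ler_sum => b _.
rewrite cnormZ_cmod ler_piMr //; first by rewrite -lecR cmodE normr_ge0.
by apply: cnormM_le1; rewrite ?cnorm_starE isometry_family_norm.
Qed.

End MatrixUnits.

(** The C*-structure depends on the family t, hence the phantom argument ht. *)
Definition mxalg (R : realType) (A : cstarType R) (t : nat -> A)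
  (ht : orthonormal_isometries t) (D : nat) : Type := 'M[R[i]]_D.+1.

Section MatrixAlgebra.
Variables (R : realType) (A : cstarType R) (t : nat -> A)
  (ht : orthonormal_isometries t) (D : nat).
Local Notation M := (mxalg ht D).

HB.instance Definition _ := Falgebra.copy M 'M[R[i]]_D.+1.

Implicit Types X Y : M.
Let nu X : R := cnorm (mxembed t X).

Lemma mxalg_starK : involutive (@cadj R D : M -> M).
Proof. by move=> X; apply/matrixP => a b; rewrite !mxE conjCK. Qed.

Lemma mxalg_starD X Y : cadj (X + Y) = cadj X + cadj Y :> M.
Proof. by apply/matrixP => a b; rewrite !mxE rmorphD. Qed.

Lemma mxalg_starZ (c : R[i]) X : cadj (c *: X) = c^* *: (cadj X : M).
Proof. by apply/matrixP => a b; rewrite !mxE rmorphM. Qed.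

Lemma mxalg_starM X Y : cadj (X * Y) = (cadj Y : M) * cadj X.
Proof.
apply/matrixP => a b; rewrite !mxE rmorph_sum; apply: eq_bigr => c _.
by rewrite !mxE rmorphM mulrC.
Qed.

Lemma mxalg_norm_eq0 X : nu X = 0 -> X = 0.
Proof.
move=> /cnorm_eq0 h; apply/matrixP => a b; rewrite mxE.
have := mxembed_entry ht X a b; rewrite h mul0r mulr0 => /esym/eqP.
by rewrite scaler_eq0 oner_eq0 orbF => /eqP.
Qed.

Lemma mxalg_normD X Y : nu (X + Y) <= nu X + nu Y.
Proof. by rewrite /nu mxembedD cnormD. Qed.

Lemma mxalg_normZ (c : R[i]) X : (nu (c *: X))%:C = `|c| * (nu X)%:C.
Proof. by rewrite /nu mxembedZ cnormZ. Qed.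

Lemma mxalg_normM X Y : nu (X * Y) <= nu X * nu Y.
Proof. by rewrite /nu mxembedM // cnormM. Qed.

Lemma mxalg_norm_star X : nu ((cadj X : M) * X) = nu X ^+ 2.
Proof. by rewrite /nu mxembedM // mxembed_star cnorm_star. Qed.

Lemma mxalg_complete (X : nat -> M) :
  (forall e : R, 0 < e -> exists n0, forall m n, (n0 <= m)%N -> (n0 <= n)%N ->
     nu (X m - X n) < e) ->
  exists L : M, (fun n => nu (X n - L)) @ \oo --> (0 : R).
Proof.
move=> hX.
have lim_entry a b : exists l, forall e : R, 0 < e ->
    exists n0, forall n, (n0 <= n)%N -> cmod (X n a b - l) < e.
  apply: complex_complete => e /hX[n0 hn0]; exists n0 => m n hm hn.
  apply: le_lt_trans (hn0 _ _ hm hn).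
  by have := cmod_entry_le ht (X m - X n) a b; rewrite !mxE.
have [l hl] := choice (fun ab : 'I_D.+1 * 'I_D.+1 => lim_entry ab.1 ab.2).
exists (\matrix_(a, b) l (a, b)).
apply/cvgrPdist_lt => e e0.
pose c : R := (D.+1 * D.+1)%:R.
have c0 : 0 < c by rewrite ltr0n.
have [n0 hn0] := choice (fun ab => hl ab _ (divr_gt0 e0 c0)).
exists (\max_ab n0 ab)%N => // n /= hn.
rewrite sub0r normrN ger0_norm ?cnorm_ge0 //.
apply: le_lt_trans (mxembed_norm_le ht _) _.
have -> : e = \sum_(a < D.+1) \sum_(b < D.+1) e / c.
  rewrite !sumr_const !card_ord -mulrnA -mulr_natr mulfVK //.
  by rewrite gt_eqF.
have lt_row (a : 'I_D.+1) :
    \sum_b cmod ((X n - \matrix_(a, b) l (a, b)) a b) < \sum_(b < D.+1) e / c.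
  apply: ltr_sum; first by apply/hasP; exists ord0; rewrite ?mem_index_enum.
  move=> b _; rewrite !mxE; apply: (hn0 (a, b)).
  exact: leq_trans (leq_bigmax (a, b)) hn.
by apply: ltr_sum => //; apply/hasP; exists ord0; rewrite ?mem_index_enum.
Qed.

HB.instance Definition _ := isCStar.Build R M mxalg_starK mxalg_starD mxalg_starZ
  mxalg_starM mxalg_norm_eq0 mxalg_normD mxalg_normZ mxalg_normM mxalg_norm_star
  mxalg_complete.


End MatrixAlgebra.
Section Rank.
Variables (R : realType) (A : cstarType R) (t : nat -> A)
  (ht : orthonormal_isometries t) (D : nat).
Local Notation M := (mxalg ht D).

(** The diagonal matrices form a maximal abelian subalgebra: a matrix commuting
with the diagonal matrix units is diagonal. *)
Lemma mxalg_rank : exists2 r, has_rank M r & (r <= D.+1)%N.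
Proof.
pose f : 'Hom('rV[R[i]]_D.+1, M) := linfun (@diag_mx R[i] D.+1 : _ -> M).
pose V : {vspace M} := limg f.
have VP (x : M) : reflect (exists u, x = diag_mx u) (x \in V).
  apply: (iffP memv_imgP) => [[u _ ->]|[u ->]]; first by exists u; rewrite lfunE.
  by exists u; rewrite ?memvf // lfunE.
exists (\dim V); last first.
  have := limg_ker_dim f fullv; rewrite dimvf /dim /= mul1n => <-.
  exact: leq_addl.
exists V => //; split.
  split.
  - move=> _ _ /VP[u ->] /VP[v ->]; apply/VP; exists (\row_i (u 0 i * v 0 i)).
    exact: mulmx_diag.
  - move=> _ /VP[u ->]; apply/VP; exists (\row_i (u 0 i)^* ).
    apply/matrixP => i j; rewrite !mxE rmorphMn eq_sym /=.
    by case: eqP => [->|].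
  - move=> _ _ /VP[u ->] /VP[v ->]; exact: diag_mxC.
move=> W [WM Wstar WC] VW; apply/eqP; rewrite eqEsubv VW andbT.
apply/subvP => x xW; apply/VP; exists (\row_i x i i).
apply/matrixP => i j; rewrite !mxE; case: eqP => [->|/eqP ij] //=.
have dW : (diag_mx (delta_mx 0 i) : M) \in W.
  by apply: (subvP VW); apply/VP; eexists.
pose e : 'M[R[i]]_D.+1 := diag_mx (delta_mx 0 i).
have : ((x : 'M[R[i]]_D.+1) *m e) i j = (e *m (x : 'M[R[i]]_D.+1)) i j.
  by have := congr1 (fun Z : M => (Z : 'M[R[i]]_D.+1) i j) (WC _ _ xW dW).
rewrite mul_mx_diag mul_diag_mx !mxE !eqxx /= (eq_sym j) (negPf ij).
by rewrite mul1r mulr0 => <-.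
Qed.

End Rank.

Section GramFactorization.
Variable R : realType.

(** By the spectral theorem: G = P^* diag(d) P with P unitary and d >= 0, and z is
diag(sqrt d) P. *)
Lemma psd_gram (T : finType) (G : T -> T -> R[i]) :
  (forall p q, G q p = (G p q)^*) ->
  (forall v : T -> R[i], 0 <= \sum_p \sum_q (v p)^* * v q * G p q) ->
  exists z : T -> T -> R[i], forall p q, G p q = \sum_r (z r p)^* * z r q.
Proof.
move=> Gh Gpos; pose H : 'M[R[i]]_#|T| := \matrix_(i, j) G (enum_val i) (enum_val j).
have Hh : H \is hermsymmx.
  apply/is_hermitianmxP; rewrite expr0 scale1r; apply/matrixP => i j.
  by rewrite !mxE Gh.
have /orthomx_spectralP HE := hermitian_normalmx Hh.
move: HE (spectral_unitarymx H); set P := spectralmx H; set d := spectral_diag H.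
move=> HE PU; rewrite (invmx_unitary PU) in HE.
have reT (F : 'I_#|T| -> R[i]) : \sum_i F i = \sum_p F (enum_rank p).
  by rewrite (reindex enum_rank) //; apply: onW_bij; apply: enum_rank_bij.
have d0 r : 0 <= d 0 r.
  have : P *m H *m map_mx Num.conj (trmx P) = diag_mx d.
    rewrite HE !mulmxA (unitarymxP PU) mul1mx -mulmxA (unitarymxP PU) mulmx1 //.
  move=> /matrixP /(_ r r); rewrite !mxE eqxx mulr1n => <-.
  have := Gpos (fun p => (P r (enum_rank p))^* ); congr (_ <= _).
  rewrite reT exchange_big /=; apply: eq_bigr => q _.
  rewrite mxE reT mulr_suml; apply: eq_bigr => p _.
  by rewrite !mxE !enum_rankK conjCK mulrAC.
exists (fun r p => sqrtC (d 0 (enum_rank r)) * P (enum_rank r) (enum_rank p)) => p q.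
have -> : G p q = H (enum_rank p) (enum_rank q) by rewrite mxE !enum_rankK.
rewrite HE !mxE reT; apply: eq_bigr => r _.
rewrite mul_mx_diag !mxE rmorphM /= mulrACA.
have -> : (sqrtC (d 0 (enum_rank r)))^* = sqrtC (d 0 (enum_rank r)).
  by apply: geC0_conj; rewrite sqrtC_ge0.
by rewrite -expr2 sqrtCK mulrCA mulrA.
Qed.

End GramFactorization.
(** * Completely positive factorizations through words *)

Section Approximation.
Variables (R : realType) (N : nat) (A : cstarType R) (s : 'I_N -> A).
Hypothesis N2 : (2 <= N)%N.
Hypothesis hs : is_cuntz_algebra s.
Variables (W : seq (seq 'I_N)) (D : nat) (c : R).
Hypothesis sizeW : size W = D.+1.
Hypothesis uniqW : uniq W.
Hypothesis c_gt0 : 0 < c.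
Hypothesis sumW : \sum_(w <- W) sw s w * star (sw s w) = (c^-1)%:C *: 1.

Local Notation sw := (sw s).
Local Notation omega := (omega N2 hs).
Local Notation t := (shift_iso s N2).
Let ht : orthonormal_isometries t := star_shift_iso N2 hs.
Local Notation M := (mxalg ht D).
Let w (a : 'I_D.+1) := nth [::] W a.

Lemma omega_sum (I : Type) (r : seq I) (F : I -> A) :
  omega (\sum_(i <- r) F i) = \sum_(i <- r) omega (F i).
Proof.
apply: (big_morph omega (omegaD N2 hs)).
by rewrite -(scale0r 0) omegaZ mul0r.
Qed.

Definition word_down (x : A) : M := \matrix_(a, b) omega (star (sw (w a)) * x * sw (w b)).

Definition word_up (X : M) : A :=
  c%:C *: \sum_a \sum_b (X : 'M[R[i]]_D.+1) a b *: (sw (w a) * star (sw (w b))).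

Lemma word_down_is_linear : linear word_down.
Proof.
move=> a x y; apply/matrixP => i j; rewrite !mxE mulrDr mulrDl omegaD.
by rewrite -scalerAr -scalerAl omegaZ.
Qed.

Lemma word_up_is_linear : linear word_up.
Proof.
move=> a X Y; rewrite /word_up scalerA mulrC -scalerA -scalerDr; congr (_ *: _).
rewrite scaler_sumr -big_split /=; apply: eq_bigr => i _.
rewrite scaler_sumr -big_split /=; apply: eq_bigr => j _.
by rewrite !mxE scalerDl scalerA.
Qed.

HB.instance Definition _ :=
  GRing.isLinear.Build R[i] A M *:%R word_down word_down_is_linear.
HB.instance Definition _ :=
  GRing.isLinear.Build R[i] M A *:%R word_up word_up_is_linear.

(** For X = Y^* Y the scalars omega (star (sw I) * X i j * sw J), indexed by the
pairs (i, I) and (j, J), form a Gram matrix for the positive form omega, so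
psd_gram applies. *)
Lemma word_down_ucp : ucp (word_down : {linear A -> M}).
Proof.
split.
  apply/matrixP => a b; rewrite !mxE mulr1 omega_star_sw nth_uniq ?sizeW //.
move=> n X [Y XE].
pose G (p q : 'I_n * 'I_D.+1) := omega (star (sw (w p.2)) * X p.1 q.1 * sw (w q.2)).
have GE p q : G p q = \sum_k omega (star (Y k p.1 * sw (w p.2)) * (Y k q.1 * sw (w q.2))).
  rewrite /G XE mxE mulr_sumr mulr_suml omega_sum; apply: eq_bigr => k _.
  by rewrite mxE starM !mulrA.
have [||z zE] := @psd_gram R _ G.
- move=> p q; rewrite !GE rmorph_sum /=; apply: eq_bigr => k _.
  by rewrite -(omega_star N2 hs) [in RHS]starM starK.
- move=> v; have -> : \sum_p \sum_q (v p)^* * v q * G p q = \sum_k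
      omega (star (\sum_p v p *: (Y k p.1 * sw (w p.2)))
             * \sum_q v q *: (Y k q.1 * sw (w q.2))).
    under [RHS]eq_bigr => k _.
      rewrite star_sum mulr_suml omega_sum.
      under eq_bigr => p _.
        rewrite mulr_sumr omega_sum.
        under eq_bigr => q _ do rewrite starZ -scalerAl -scalerAr !omegaZ mulrA.
        over.
      over.
    rewrite [RHS]exchange_big /=; apply: eq_bigr => p _.
    rewrite [RHS]exchange_big /=; apply: eq_bigr => q _.
    by rewrite GE mulr_sumr.
  by apply: sumr_ge0 => k _; apply: omega_pos.
exists (\matrix_(k, j) (\matrix_(a, b) z (k, a) (j, b) : M)).
apply/matrixP => i j; rewrite !mxE; apply/matrixP => a b; rewrite !mxE.
rewrite (_ : omega _ = G (i, a) (j, b)) // zE.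
rewrite (eq_bigr (fun r => (z (r.1, r.2) (i, a))^* * z (r.1, r.2) (j, b))); last by case.
rewrite -(pair_bigA _ (fun k d => (z (k, d) (i, a))^* * z (k, d) (j, b))) /=.
rewrite summxE; apply: eq_bigr => k _; rewrite !mxE.
by apply: eq_bigr => d _; rewrite !mxE.
Qed.

(** Row p of X, paired with the row of the star (sw I). *)
Let rowc (X : M) (p : 'I_D.+1) : A :=
  \sum_b (X : 'M[R[i]]_D.+1) p b *: star (sw (w b)).

Lemma word_up_gram (X Y : M) :
  word_up (star X * Y) = c%:C *: \sum_p star (rowc X p) * rowc Y p.
Proof.
rewrite /word_up; congr (_ *: _).
under [RHS]eq_bigr => p _.
  rewrite /rowc star_sum mulr_suml.
  under eq_bigr => a _.
    rewrite mulr_sumr.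
    under eq_bigr => b _ do rewrite starZ starK -scalerAl -scalerAr scalerA.
    over.
  over.
rewrite [RHS]exchange_big /=; apply: eq_bigr => a _.
rewrite [RHS]exchange_big /=; apply: eq_bigr => b _.
rewrite !mxE scaler_suml; apply: eq_bigr => p _.
by rewrite !mxE.
Qed.

Lemma sum_isometries (x y : 'I_D.+1 -> A) :
  star (\sum_(p < D.+1) t p * x p) * (\sum_(q < D.+1) t q * y q) = \sum_p star (x p) * y p.
Proof.
rewrite star_sum mulr_suml; apply: eq_bigr => p _.
rewrite mulr_sumr (bigD1 p) //= big1 ?addr0 => [|q qp].
  by rewrite starM mulrA -(mulrA (star (x p))) ht eqxx mulr1.
rewrite starM mulrA -(mulrA (star (x p))) ht (inj_eq val_inj).
by rewrite eq_sym (negPf qp) mulr0 mul0r.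
Qed.

(** By word_up_gram the image of Y^* Y is a sum over both a matrix index k and a
row index p; the isometries t p with orthogonal ranges absorb the sum over p
into a single square matrix over A. *)
Lemma word_up_ucp : ucp (word_up : {linear M -> A}).
Proof.
split.
  rewrite /= /word_up.
  have -> : \sum_a \sum_b (1 : 'M[R[i]]_D.+1) a b *: (sw (w a) * star (sw (w b)))
      = \sum_(v <- W) sw v * star (sw v).
    rewrite (big_nth [::]) big_mkord sizeW; apply: eq_bigr => a _.
    rewrite (bigD1 a) //= big1 ?addr0 => [|b ba]; first by rewrite mxE eqxx scale1r.
    by rewrite mxE eq_sym (negPf ba) scale0r.
  by rewrite sumW scalerA -rmorphM /= mulfV ?scale1r // gt_eqF.
move=> n X [Y XE].
exists (\matrix_(k, j) ((Num.sqrt c)%:C *: \sum_(p < D.+1) t p * rowc (Y k j) p)).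
apply/matrixP => i j; rewrite !mxE XE mxE linear_sum; apply: eq_bigr => k _.
rewrite !mxE /= word_up_gram starZr -scalerAl -scalerAr scalerA -rmorphM /=.
by rewrite -expr2 sqr_sqrtr ?ltW // sum_isometries.
Qed.

Lemma word_up_down (x : A) : word_up (word_down x) =
  c%:C *: \sum_(I <- W) \sum_(J <- W) omega (star (sw I) * x * sw J) *: (sw I * star (sw J)).
Proof.
rewrite /word_up; congr (_ *: _).
rewrite (big_nth [::]) big_mkord sizeW; apply: eq_bigr => a _.
rewrite (big_nth [::]) big_mkord sizeW; apply: eq_bigr => b _.
by rewrite mxE.
Qed.

Lemma word_up_down_contractive (x : A) : cnorm (word_up (word_down x)) <= cnorm x.
Proof.
have t0 : star (t 0) * t 0 = 1 by rewrite ht.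
have t1 : star (t 1) * t 1 = 1 by rewrite ht.
have t01 : star (t 0) * t 1 = 0 by rewrite ht.
have [d1 dP] := word_down_ucp; have [u1 uP] := word_up_ucp.
pose f := (word_up : {linear M -> A}) \o (word_down : {linear A -> M}).
apply: (ucp_contractive (f := f) t0 t1 t01).
split; first by rewrite /= d1.
by move=> n X /dP /uP; rewrite -map_mx_comp.
Qed.

End Approximation.

Section WordBlocks.
Variables (R : realType) (N : nat) (A : cstarType R) (s : 'I_N -> A).
Hypothesis N2 : (2 <= N)%N.
Hypothesis hs : is_cuntz_algebra s.
Local Notation sw := (sw s).
Local Notation omega := (omega N2 hs).
Local Notation words := (words N).

(** The contribution of words of lengths i and j to the composite map. *)
Definition block i j (x : A) : A :=
  \sum_(I <- words i) \sum_(J <- words j) omega (star (sw I) * x * sw J) *: (sw I * star (sw J)).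

Lemma block_addl i j k x : block i.+1 j (s k * x) = s k * block i j x.
Proof.
rewrite /block sum_wordsS (bigD1 k) //= [X in _ + X]big1 ?addr0 => [|l lk].
  rewrite mulr_sumr; apply: eq_bigr => I _.
  rewrite mulr_sumr; apply: eq_bigr => J _.
  rewrite !sw_cons starM !mulrA -(mulrA _ _ (s k)) (ss hs) eqxx mulr1.
  by rewrite -scalerAr !mulrA.
rewrite big1 // => I _; rewrite big1 // => J _.
rewrite sw_cons starM !mulrA -(mulrA _ _ (s k)) (ss hs) (negPf lk).
by rewrite mulr0 !mul0r -(scale0r 0) omegaZ mul0r !scale0r.
Qed.

Lemma block_star i j x : block i j (star x) = star (block j i x).
Proof.
rewrite /block exchange_big /= star_sum; apply: eq_bigr => J _.
rewrite star_sum; apply: eq_bigr => I _.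
by rewrite starZ starM starK -omega_star !starM starK mulrA.
Qed.

Lemma block_word i j P Q :
  block (size P + i) (size Q + j) (sw P * star (sw Q)) = sw P * block i j 1 * star (sw Q).
Proof.
elim: P => [|k P IH]; last by rewrite sw_cons -!mulrA block_addl IH !mulrA.
rewrite add0n sw_nil !mul1r.
elim: Q => [|k Q IH]; first by rewrite add0n sw_nil star1 mulr1.
by rewrite block_star sw_cons addSn block_addl !starM -block_star IH mulrA.
Qed.

Lemma block1 i j : block i j 1 = (i == j)%:R *: 1.
Proof.
rewrite /block; have [<-|ij] := eqVneq i j.
  rewrite scale1r -[RHS](sum_words_range hs i); apply: eq_big_seq => I.
  rewrite mem_words => /eqP hI; rewrite (bigD1_seq I) ?uniq_words ?mem_words ?hI //=.
  rewrite mulr1 omega_star_sw eqxx scale1r big1 ?addr0 // => J JI.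
  by rewrite omega_star_sw eq_sym (negPf JI) scale0r.
rewrite scale0r big_seq big1 // => I; rewrite mem_words => /eqP hI.
rewrite big_seq big1 // => J; rewrite mem_words => /eqP hJ.
rewrite mulr1 omega_star_sw; case: eqP => [IJ|_]; last by rewrite scale0r.
by rewrite -hI -hJ IJ eqxx in ij.
Qed.

End WordBlocks.
(** * Fejer means over a window of word lengths *)

Section Window.
Variables (R : realType) (N : nat) (A : cstarType R) (s : 'I_N -> A).
Hypothesis N2 : (2 <= N)%N.
Hypothesis hs : is_cuntz_algebra s.
Local Notation sw := (sw s).
Local Notation omega := (omega N2 hs).
Local Notation words := (words N).
Local Notation block := (block N2 hs).
Implicit Types (x y : A) (m M p q : nat).

Definition window m M : seq (seq 'I_N) := [seq w | l <- iota m M, w <- words l].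

Lemma sum_window (V : zmodType) (F : seq 'I_N -> V) m M :
  \sum_(w <- window m M) F w = \sum_(l <- iota m M) \sum_(w <- words l) F w.
Proof. exact: big_allpairs_dep. Qed.

Lemma mem_window m M w : w \in window m M -> (m <= size w)%N.
Proof.
move=> /allpairsPdep[l [v [hl hv ->]]]; move: hl hv.
by rewrite mem_iota mem_words => /andP[? _] /eqP->.
Qed.

Lemma windowS m M : window m M.+1 = words m ++ window m.+1 M.
Proof. by rewrite /window /= map_id. Qed.

Lemma uniq_window m M : uniq (window m M).
Proof.
elim: M m => [//|M IH] m; rewrite windowS cat_uniq uniq_words IH andbT /=.
by apply/hasPn => w /mem_window hw; rewrite mem_words neq_ltn hw orbT.
Qed.

Lemma size_window_gt0 m M : (0 < size (window m M.+1))%N.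
Proof. by rewrite windowS size_cat size_words addn_gt0 expn_gt0 ltnW. Qed.

Lemma size_window_le m M : (size (window m M) <= M * N ^ (m + M))%N.
Proof.
elim: M m => [//|M IH] m; rewrite windowS size_cat size_words mulSn -addSnnS.
by apply: leq_add => //; rewrite leq_exp2l // ltnW // ltnS leq_addr.
Qed.

Definition fejer m M x : A := (M%:R^-1)%:C *:
  \sum_(I <- window m M) \sum_(J <- window m M)
     omega (star (sw I) * x * sw J) *: (sw I * star (sw J)).

Lemma fejerD m M x y : fejer m M (x + y) = fejer m M x + fejer m M y.
Proof.
rewrite /fejer -scalerDr -big_split /=; congr (_ *: _); apply: eq_bigr => I _.
rewrite -big_split /=; apply: eq_bigr => J _.
by rewrite mulrDr mulrDl omegaD scalerDl.
Qed.

Lemma fejerZ m M (a : R[i]) x : fejer m M (a *: x) = a *: fejer m M x.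
Proof.
rewrite /fejer scalerA mulrC -scalerA; congr (_ *: _).
rewrite scaler_sumr; apply: eq_bigr => I _.
rewrite scaler_sumr; apply: eq_bigr => J _.
by rewrite -scalerAr -scalerAl omegaZ scalerA.
Qed.

Lemma fejer_block m M x : fejer m M x = (M%:R^-1)%:C *:
  \sum_(i <- iota m M) \sum_(j <- iota m M) block i j x.
Proof.
rewrite /fejer sum_window; congr (_ *: _); apply: eq_bigr => i _.
under eq_bigr => I _ do rewrite sum_window.
by rewrite exchange_big.
Qed.

(** The number of pairs of positions in a window of size M whose difference is
p - q, that is (M - |p - q|)^+. *)
Definition overlap M p q : nat :=
  (\sum_(0 <= i < M) \sum_(0 <= j < M) (i + q == j + p))%N.

Lemma overlap_le M p q : (overlap M p q <= M)%N.
Proof.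
rewrite -[leqRHS](subn0 M) -[leqRHS]muln1 -sum_nat_const_nat; apply: leq_sum => i _.
have -> : (\sum_(0 <= j < M) (i + q == j + p) = count (fun j => i + q == j + p) (iota 0 M))%N.
  by rewrite -sum1_count [RHS]big_mkcond /= /index_iota subn0; apply: eq_bigr => j _; case: eqP.
have [le|lt] := leqP p (i + q).
  rewrite (@eq_count _ _ (pred1 (i + q - p)%N)) => [|j /=]; last by apply/eqP/eqP; lia.
  by rewrite count_uniq_mem ?iota_uniq // leq_b1.
rewrite (@eq_count _ _ pred0) ?count_pred0 // => j /=; apply/eqP; lia.
Qed.

Lemma overlap_ge M p q : (M <= overlap M p q + ((p - q) + (q - p)))%N.
Proof.
rewrite addnC -leq_subLR.
have [h|h] := leqP (p - q) (M - (q - p)); last by lia.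
have h' : (M - (q - p) <= M)%N by lia.
rewrite /overlap (big_cat_nat (leq0n (M - (q - p))) h').
rewrite (big_cat_nat (leq0n (p - q)) h) /=.
apply: leq_trans (leq_addr _ _); apply: leq_trans (leq_addl _ _).
apply: (@leq_trans (\sum_(p - q <= i < M - (q - p)) 1)%N).
  by rewrite sum_nat_const_nat; lia.
rewrite big_nat [leqRHS]big_nat; apply: leq_sum => i /andP[h1 h2].
have hj : (i + q - p)%N \in index_iota 0 M by rewrite mem_index_iota; lia.
rewrite (bigD1_seq _ hj) ?iota_uniq //= (_ : (_ == _) = true) //; apply/eqP; lia.
Qed.

(** By block_word and block1, the block of lengths (m + i, m + j) sends
sw P * star (sw Q) to itself when m + i - p = m + j - q, and to 0 otherwise. *)
Lemma fejer_wspan m M p q x : (p <= m)%N -> (q <= m)%N -> wspan s p q x ->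
  fejer m M x = ((overlap M p q)%:R / M%:R)%:C *: x.
Proof.
move=> pm qm; elim=> [|a P Q y hP hQ _ IH].
  by rewrite scaler0; have := fejerZ m M 0 0; rewrite !scale0r.
rewrite fejerD fejerZ IH scalerDr; congr (_ + _).
rewrite scalerA [in RHS]mulrC -scalerA; congr (_ *: _).
rewrite fejer_block mulrC rmorphM /= -scalerA; congr (_ *: _).
(* Positions are counted from the start of the window, as in overlap. *)
rewrite -{1 2}(addn0 m) !iotaDl !big_map.
rewrite /overlap /index_iota subn0 (rmorph_nat (real_complex R)) natr_sum scaler_suml.
apply: eq_bigr => i _; rewrite big_map natr_sum scaler_suml; apply: eq_bigr => j _.
have := block_word N2 hs (m + i - p) (m + j - q) P Q.
rewrite hP hQ !subnKC ?(leq_trans _ (leq_addr _ _)) // => ->.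
rewrite block1 -scalerAr -scalerAl mulr1; congr (_%:R *: _).
by congr nat_of_bool; apply/eqP/eqP; lia.
Qed.

(** The bound depends on p and q only through their difference, and not on the
start m of the window. *)
Lemma fejer_error m M p q x : (p <= m)%N -> (q <= m)%N -> wspan s p q x -> (0 < M)%N ->
  cnorm (fejer m M x - x) <= ((p - q) + (q - p))%:R * cnorm x / M%:R.
Proof.
move=> pm qm hx M0; rewrite (fejer_wspan M pm qm hx).
have M0R : 0 < M%:R :> R by rewrite ltr0n.
have -> : ((overlap M p q)%:R / M%:R)%:C *: x - x
   = (- ((M - overlap M p q)%:R / M%:R))%:C *: x.
  rewrite -{2}(scale1r x) -scalerBl; congr (_ *: _).
  rewrite -(rmorph1 (real_complex R)) -rmorphB /=; congr (_%:C).
  by rewrite natrB ?overlap_le //; field; rewrite gt_eqF.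
rewrite cnormZ_real normrN ger0_norm ?divr_ge0 ?ler0n // mulrAC.
rewrite ler_wpM2r ?invr_ge0 ?ler0n // ler_wpM2r ?cnorm_ge0 // ler_nat.
have := overlap_ge M p q; lia.
Qed.

Lemma fejer_factors m M : (0 < M)%N ->
  exists D (ht : orthonormal_isometries (shift_iso s N2))
    (phi : {linear mxalg ht D -> A}) (psi : {linear A -> mxalg ht D}),
  [/\ size (window m M) = D.+1, ucp phi, ucp psi, forall x, phi (psi x) = fejer m M x
    & forall x, cnorm (fejer m M x) <= cnorm x].
Proof.
case: M => // M _; have W0 := size_window_gt0 m M.
pose D := (size (window m M.+1)).-1.
have sizeW : size (window m M.+1) = D.+1 by rewrite prednK.
have sumW : \sum_(w <- window m M.+1) sw w * star (sw w) = ((M.+1%:R^-1)^-1)%:C *: 1 :> A.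
  rewrite sum_window; under eq_bigr do rewrite (sum_words_range hs).
  rewrite big_const_seq count_predT size_iota invrK (rmorph_nat (real_complex R)).
  by rewrite iter_addr_0 scaler_nat.
have c0 : 0 < M.+1%:R^-1 :> R by rewrite invr_gt0.
exists D, (star_shift_iso N2 hs).
exists (word_up (N2 := N2) (hs := hs) (window m M.+1) (D := D) M.+1%:R^-1).
exists (word_down N2 hs (window m M.+1) D).
split => //.
- exact: word_up_ucp.
- by apply: word_down_ucp => //; apply: uniq_window.
- by move=> x; exact: word_up_down.
move=> x; rewrite /fejer -(word_up_down N2 hs _ sizeW).
by apply: word_up_down_contractive => //; apply: uniq_window.
Qed.

End Window.
(** * The endomorphism and its entropy *)

Section Endomorphism.
Variables (R : realType) (N : nat) (A : cstarType R) (s : 'I_N -> A).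
Hypothesis N2 : (2 <= N)%N.
Hypothesis hs : is_cuntz_algebra s.
Variables (k : nat) (u : A) (rho : {lrmorphism A -> A}).
Hypothesis u_span : wspan s k.+1 k.+1 u.
Hypothesis rhoE : is_rho s u rho.
Local Notation sw := (sw s).
Local Notation fejer := (fejer N2 hs).

(** rho (s_i) = u s_i lies in wspan (k+1) k; in a product of such factors only the
first index accumulates, because the second one is absorbed by the next
factor. *)
Lemma wspan_rho_word P : wspan s (size P + k) k (rho (sw P)).
Proof.
elim: P => [|i P IH].
  rewrite sw_nil rmorph1; apply: (wspan_lift hs k (p := 0) (q := 0)).
  by have := wspan_word s [::] [::]; rewrite sw_nil star1 mulr1.
rewrite sw_cons rmorphM /= rhoE.2.
have si : wspan s (1 + k) (0 + k) (s i).
  apply: (wspan_lift hs); have := wspan_word s [:: i] [::].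
  by rewrite sw_cons !sw_nil star1 !mulr1.
have := wspan_lift hs (size P) (wspan_mul hs u_span si).
rewrite add0n addSn (addnC k) /= addSn => usi. exact: (wspan_mul hs usi IH).
Qed.

Lemma wspan_rho p q x : wspan s p q x -> wspan s (p + k) (q + k) (rho x).
Proof.
elim=> [|a P Q y <- <- _ IH]; first by rewrite rmorph0; apply: wspan0.
rewrite linearD linearZ; apply: wspan_add => //; apply: wspan_scale.
rewrite rmorphM /= rhoE.1; apply: (wspan_mul hs (wspan_rho_word P)).
exact: wspan_star (wspan_rho_word Q).
Qed.

Lemma wspan_iter_rho j p q x :
  wspan s p q x -> wspan s (p + j * k) (q + j * k) (iter j rho x).
Proof.
elim: j => [|j IH] hx; first by rewrite !mul0n !addn0.
by rewrite mulSn [(k + _)%N]addnC !addnA; apply/wspan_rho/IH.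
Qed.

Lemma iter_rhoD j x y : iter j rho (x + y) = iter j rho x + iter j rho y.
Proof. by elim: j => //= j ->; rewrite rmorphD. Qed.

Lemma iter_rho_contractive j x : cnorm (iter j rho x) <= cnorm x.
Proof.
elim: j => //= j; apply: le_trans.
exact: star_morph_contractive rhoE.1 _.
Qed.

(** The constants l and C do not depend on j: the degrees of the components of
rho^j y, and so the error bounds, are those of y. *)
Lemma fejer_rho_wpoly y : wpoly s y -> exists l (C : R), 0 <= C /\
  forall m M j, (l + j * k <= m)%N -> (0 < M)%N ->
    cnorm (fejer m M (iter j rho y) - iter j rho y) <= C / M%:R.
Proof.
elim=> [p q x hx|x1 x2 _ [l1 [C1 [C10 h1]]] _ [l2 [C2 [C20 h2]]]].
  exists (p + q)%N, (((p - q) + (q - p))%:R * cnorm x).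
  split=> [|m M j hm M0]; first by rewrite mulr_ge0 ?ler0n ?cnorm_ge0.
  have pm : (p + j * k <= m)%N by lia.
  have qm : (q + j * k <= m)%N by lia.
  apply: le_trans (fejer_error N2 hs pm qm (wspan_iter_rho j hx) M0) _.
  rewrite !subnDr ler_wpM2r ?invr_ge0 ?ler0n // ler_wpM2l ?ler0n //.
  exact: iter_rho_contractive.
exists (l1 + l2)%N, (C1 + C2); split=> [|m M j hm M0]; first exact: addr_ge0.
rewrite iter_rhoD fejerD opprD addrACA mulrDl.
apply: le_trans (cnormD _ _) _; apply: lerD; [apply: h1|apply: h2] => //; lia.
Qed.

(** All maps involved are contractions, so the estimate passes from word
polynomials to their limits, with n0 still independent of j. *)
Lemma fejer_rho x (e : R) : 0 < e -> exists n0, forall m M j,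
  (n0 + j * k <= m)%N -> (n0 < M)%N ->
    cnorm (fejer m M (iter j rho x) - iter j rho x) < e.
Proof.
move=> e0; have e3 : 0 < e / 3 by rewrite divr_gt0.
have [y py xy] := wpoly_dense hs x e3.
have [l [C [C0 hC]]] := fejer_rho_wpoly py.
have CT := truncnS_gt (C / (e / 3)); set T := Num.truncn _ in CT.
exists (l + T)%N => m M j hm hM.
have M0 : (0 < M)%N by lia.
have h1 : cnorm (fejer m M (iter j rho y) - iter j rho y) <= C / M%:R by apply: hC => //; lia.
have h2 : C / M%:R < e / 3.
  rewrite ltr_pdivrMr ?ltr0n // mulrC -ltr_pdivrMr //.
  apply: lt_le_trans CT _; rewrite ler_nat; lia.
have [D [ht [phi [psi [_ _ _ _ contr]]]]] := fejer_factors N2 hs m M0.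
have h3 : cnorm (fejer m M (iter j rho x) - fejer m M (iter j rho y)) <= cnorm (y - x).
  rewrite -scaleN1r -fejerZ -fejerD scaleN1r; apply: le_trans (contr _) _.
  have -> : iter j rho x - iter j rho y = iter j rho (x - y).
    by rewrite iter_rhoD; congr (_ + _); elim: j {hm h1} => //= j <-; rewrite rmorphN.
  by rewrite cnorm_distC; apply: iter_rho_contractive.
have h4 : cnorm (iter j rho y - iter j rho x) <= cnorm (y - x).
  have -> : iter j rho y - iter j rho x = iter j rho (y - x).
    by rewrite iter_rhoD; congr (_ + _); elim: j {hm h1 h3} => //= j <-; rewrite rmorphN.
  exact: iter_rho_contractive.
have := cnorm_dist_trans (fejer m M (iter j rho y)) (fejer m M (iter j rho x)) (iter j rho x).
have := cnorm_dist_trans (iter j rho y) (fejer m M (iter j rho y)) (iter j rho x).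
lra.
Qed.

Lemma fejer_rho_finite (Omega : set A) (e : R) : 0 < e -> finite_set Omega ->
  exists n0, forall x, Omega x -> forall m M j,
    (n0 + j * k <= m)%N -> (n0 < M)%N ->
    cnorm (fejer m M (iter j rho x) - iter j rho x) < e.
Proof.
move=> e0 /finite_seqP[r ->]; elim: r => [|x r [n1 h1]]; first by exists 0%N.
have [n2 h2] := fejer_rho x e0; exists (n1 + n2)%N => y /=.
rewrite inE => /orP[/eqP ->|yr] m M j hm hM.
  by apply: h2; lia.
by apply: h1 => //; lia.
Qed.

Lemma rcp_rho_le (Omega : set A) (e : R) : 0 < e -> finite_set Omega ->
  exists n0, forall n, (rcp (iterates rho Omega n) e
     <= (n0.+1 * N ^ (n0 + n0.+1 + n * k))%:R%:E)%E.
Proof.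
move=> e0 fO; have [n0 hn0] := fejer_rho_finite e0 fO; exists n0 => n.
have [D [ht [phi [psi [sD phiU psiU pp _]]]]] :=
  fejer_factors N2 hs (n0 + n * k) (ltn0Sn n0).
have [r hr rD] := mxalg_rank ht D.
apply: (@le_trans _ _ r%:R%:E); last first.
  rewrite lee_fin ler_nat; apply: leq_trans rD _; rewrite -sD.
  by apply: leq_trans (size_window_le N2 _ _) _; rewrite addnAC.
apply: ereal_inf_lbound; exists r => //; exists (mxalg ht D), phi, psi; split => //.
split => // _ [j /= jn [x Ox <-]]; rewrite pp; apply: hn0 => //.
by rewrite leq_add2l leq_mul2r jn orbT.
Qed.

Lemma ht_rho_le : (ht rho <= (k%:R * ln (N%:R : R))%:E)%E.
Proof.
apply: ge_ereal_sup => _ [e [ Omega [e0 fO ->]]].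
have [n0 hn0] := rcp_rho_le e0 fO.
have N0 : 0 < N%:R :> R by rewrite ltr0n ltnW.
(* ln of the bound of rcp_rho_le at n is c + n k ln N. *)
pose c : R := ln n0.+1%:R + (n0 + n0.+1)%:R * ln N%:R.
apply/lee_addgt0Pr => d d0.
have [n1 _ hn1] : \forall n \near \oo, `|c| / n.+1%:R < d.
  have : (fun n => `|c| * n.+1%:R^-1) @ \oo --> (`|c| * 0 : R).
    by apply: cvgMr; exact: cvg_harmonic.
  rewrite mulr0 => /cvgrPdist_lt /(_ _ d0) [n1 _ hn1]; exists n1 => // n /hn1 /=.
  by rewrite sub0r normrN ger0_norm // mulr_ge0 // invr_ge0.
rewrite /limn_esup /limf_esup.
apply: (@le_trans _ _ (ereal_sup ((fun n => ((n%:R^-1)%:E * lne (rcp (iterates rho Omega n) e))%E)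
   @` [set n | (n1.+1 <= n)%N]))).
  apply: ereal_inf_lbound; exists [set n | (n1.+1 <= n)%N] => //.
  by exists n1.+1.
apply: ge_ereal_sup => _ [[|n] //= hn <-].
have rcp0 : (0 <= rcp (iterates rho Omega n.+1) e)%E.
  by apply/ereal_infP => _ [r _ <-]; rewrite lee_fin ler0n.
have lne_le : (lne (rcp (iterates rho Omega n.+1) e) <=
     (c + n.+1%:R * (k%:R * ln N%:R))%:E)%E.
  apply: (@le_trans _ _ (lne (n0.+1 * N ^ (n0 + n0.+1 + n.+1 * k))%:R%:E)).
    rewrite lee_lne //; rewrite in_itv /= ?rcp0 ?leey ?andbT // lee_fin ler0n //.
  have p0 : (0 < n0.+1%:R :> R) by rewrite ltr0n.
  rewrite lne_EFin ?ltr0n ?muln_gt0 ?expn_gt0 ?(ltnW N2) // lee_fin.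
  rewrite natrM natrX lnM ?posrE ?exprn_gt0 // lnXn // /c -[ln _ *+ _]mulr_natl.
  by rewrite (natrD _ (n0 + n0.+1)) natrM mulrDl addrA mulrA.
have inv0 : (0 <= (n.+1%:R^-1)%:E :> \bar R)%E by rewrite lee_fin invr_ge0.
apply: le_trans (lee_wpmul2l inv0 lne_le) _.
rewrite -EFinM -EFinD lee_fin mulrDr mulKf ?pnatr_eq0 // addrC lerD2l.
have /ltW := hn1 n hn; apply: le_trans; rewrite mulrC.
by rewrite ler_wpM2r ?invr_ge0 // ler_norm.
Qed.

End Endomorphism.

Lemma cuntz_F_wspan (R : realType) (N k : nat) (A : cstarType R) (s : 'I_N -> A) u :
  cuntz_F s k u -> wspan s k k u.
Proof.
move=> [c ->]; apply: wspan_sum => I; apply: wspan_sum => J; apply: wspan_scale.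
have := wspan_word s (tval I) (tval J); rewrite !size_tuple; exact.
Qed.

Lemma perm_unitary_cuntz_F (R : realType) (N k : nat) (A : cstarType R) (s : 'I_N -> A)
  (sigma : {perm k.-tuple 'I_N}) : cuntz_F s k (perm_unitary s sigma).
Proof.
exists (fun I J => (I == sigma J)%:R); rewrite exchange_big; apply: eq_bigr => J _.
rewrite (bigD1 (sigma J)) //= eqxx scale1r big1 ?addr0 // => I /negPf ->.
by rewrite scale0r.
Qed.

Theorem theorem2p2 (R : realType) (N k : nat) (hN : (2 <= N)%N) (hk : (1 <= k)%N)
    (A : cstarType R) (s : 'I_N -> A) (hs : is_cuntz_algebra s) :
  (forall (u : A) (rho : {lrmorphism A -> A}),
     cuntz_F s k u -> unitary_elt u -> is_rho s u rho ->
     (ht rho <= ((k%:R - 1) * ln (N%:R : R))%:E)%E) /\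
  (forall (sigma : {perm k.-tuple 'I_N}) (rho : {lrmorphism A -> A}),
     is_rho s (perm_unitary s sigma) rho ->
     (ht rho <= ((k%:R - 1) * ln (N%:R : R))%:E)%E).
Proof.
have main (u : A) (rho : {lrmorphism A -> A}) : cuntz_F s k u -> is_rho s u rho ->
    (ht rho <= ((k%:R - 1) * ln (N%:R : R))%:E)%E.
  case: k hk => // k' _ /cuntz_F_wspan hu hrho.
  by rewrite -natr1 addrK; apply: (ht_rho_le hN hs hu hrho).
split=> [u rho hu _|sigma rho]; first exact: main.
exact/main/perm_unitary_cuntz_F.
Qed.
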